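(* Let $k\ge 2$ be an integer, let $N\in\{0,1,\dots,2k-1\}$, and let $\phi(z)=\sum_{i=0}^N\bar z^i\in L^\infty(\mathbb{D},dA)$. Let $\sigma_{AP}(S_\phi^k)$ and $\sigma(S_\phi^k)$ denote respectively the approximate point spectrum and the spectrum of the $k$th-order slant little Hankel operator $S_\phi^k$ on $L_a^2(\mathbb{D},dA)$. Then $$\sigma_{AP}(S_\phi^k)=\sigma(S_\phi^k).$$
   Context: $\mathbb{D}=\{z\in\mathbb{C}:|z|<1\}$ and $dA$ is Lebesgue area measure on $\mathbb{D}$ normalized so that $\mathbb{D}$ has measure $1$. $L^2(\mathbb{D},dA)$ has inner product $\langle f,g\rangle=\int_{\mathbb{D}} f\overline{g}\,dA$, and the Bergman space $L_a^2(\mathbb{D},dA)$ is the closed subspace of analytic functions in $L^2(\mathbb{D},dA)$; $\{\sqrt{n+1}\,z^n\}_{n\ge 0}$ is an orthonormal basis of it. $P: L^2(\mathbb{D},dA)\to L_a^2(\mathbb{D},dA)$ is the orthogonal projection. $J:L^2(\mathbb{D},dA)\to L^2(\mathbb{D},dA)$ is given by $(Jf)(z)=f(\bar z)$, and $M_\phi f=\phi f$. For $\phi\in L^\infty(\mathbb{D},dA)$ the little Hankel operator $H_\phi$ on $L_a^2(\mathbb{D},dA)$ is $H_\phi f = PJM_\phi f$. For an integer $k\ge 2$, $W_k$ is the bounded linear operator on $L_a^2(\mathbb{D},dA)$ determined by $W_k(z^{kn})=z^n$ and $W_k(z^{kn+p})=0$ for all integers $n\ge 0$ and $p=1,\dots,k-1$.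 The $k$th-order slant little Hankel operator with symbol $\phi$ is the bounded operator $S_\phi^k = W_kH_\phi$ on $L_a^2(\mathbb{D},dA)$. For a bounded operator $T$, the spectrum $\sigma(T)$ is the set of $\lambda\in\mathbb{C}$ such that $\lambda I-T$ is not invertible, and the approximate point spectrum $\sigma_{AP}(T)$ is the set of $\lambda\in\mathbb{C}$ such that $\lambda I-T$ is not bounded below. *)

(* Defs.v *)
From HB Require Import structures.
From mathcomp Require Import all_boot all_order all_algebra.
From mathcomp Require Import complex.
From mathcomp Require Import all_classical all_reals all_analysis.
From mathcomp Require Import lra.

Set Implicit Arguments.
Unset Strict Implicit.
Unset Printing Implicit Defensive.

Import Order.TTheory GRing.Theory Num.Theory numFieldNormedType.Exports.

Local Open Scope classical_set_scope.
Local Open Scope ring_scope.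
Local Open Scope complex_scope.

(* Functions are typed [R[i] -> R[i]^o]: the regular algebra [R[i]^o] (which is
   convertible to [R[i]]) carries the R[i]-module structure and the topology. *)

Section Disc.
Variable R : realType.
Local Notation C := R[i].
Local Notation RR := (measurableTypeR R * measurableTypeR R)%type.
Local Notation Re := (@complex.Re R).
Local Notation Im := (@complex.Im R).

Definition toC (p : RR) : C := p.1 +i* p.2.

Definition disc : set C := [set z | Normc.normc z < 1].

(* the same disc in the coordinates (x, y) of R * R, where the area measure is *)
Definition disc2 : set RR := toC @^-1` disc.

Fact inv_pi_ge0 : 0 <= pi^-1 :> R.
Proof. by rewrite invr_ge0 pi_ge0. Qed.

Definition dA : {measure set RR -> \bar R} :=
  mscale (NngNum inv_pi_ge0) (@lebesgue_measure R \x @lebesgue_measure R)%E.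

Definition integralC (f : C -> C^o) : C :=
  (\int[dA]_(p in disc2) Re (f (toC p)))
    +i* (\int[dA]_(p in disc2) Im (f (toC p))).

(* Only the values on the disc matter; functions are not identified when they
   agree almost everywhere. *)
Definition L2 (f : C -> C^o) : Prop :=
  [/\ measurable_fun disc2 (Re \o f \o toC),
      measurable_fun disc2 (Im \o f \o toC) &
      dA.-integrable disc2 (fun p => (Normc.normc (f (toC p)) ^+ 2)%:E)].

Definition dotL2 (f g : C -> C^o) : C := integralC (fun z => f z * (g z)^*).

Definition normL2 (f : C -> C^o) : R := Num.sqrt (Re (dotL2 f f)).

Definition analytic_at (f : C -> C^o) (z0 : C) : Prop :=
  exists (a : nat -> C) (r : R), 0 < r /\
    forall z, Normc.normc (z - z0) < r ->
      (series (fun n => a n * (z - z0) ^+ n) : nat -> C^o) @ \oo --> f z.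

(* The elements of the Bergman space are extended by 0 outside of the disc, so
   that equality in this space is equality on the disc. *)
Definition bergman_set : set (C -> C^o) := [set f |
  [/\ forall z, disc z -> analytic_at f z, L2 f & forall z, ~ disc z -> f z = 0]].

Definition bergman_pred : {pred C -> C^o} := [pred f | f \in bergman_set].

Lemma measurable_disc2 : measurable disc2.
Proof.
have -> : disc2 = setT `&` (fun p : RR => p.1 ^+ 2 + p.2 ^+ 2) @^-1` `]-oo, 1[.
  rewrite setTI; apply/seteqP; split=> -[x y]; rewrite /disc2 /disc /= in_itv /=;
    have H := @ltr_sqrt R (x ^+ 2 + y ^+ 2) 1 ltr01; by move: H; rewrite sqrtr1 => ->.
have h : measurable_fun setT (fun p : RR => p.1 ^+ 2 + p.2 ^+ 2).
  apply: measurable_realfun.measurable_funD;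
    apply: measurable_realfun.measurable_funX;
    [exact: measurable_fst|exact: measurable_snd].
exact: h.
Qed.

Lemma sqr_normcE (z : C) : Normc.normc z ^+ 2 = Re z ^+ 2 + Im z ^+ 2.
Proof. by case: z => x y /=; rewrite sqr_sqrtr ?addr_ge0 ?sqr_ge0. Qed.

Lemma normc_nneg (z : C) : 0 <= Normc.normc z.
Proof. by case: z => x y; exact: sqrtr_ge0. Qed.

Lemma measurable_normc2 (f : C -> C^o) :
  measurable_fun disc2 (Re \o f \o toC) -> measurable_fun disc2 (Im \o f \o toC) ->
  measurable_fun disc2 (fun p => Normc.normc (f (toC p)) ^+ 2).
Proof.
move=> mr mi; under eq_fun do rewrite sqr_normcE.
apply: measurable_realfun.measurable_funD; exact: measurable_realfun.measurable_funX.
Qed.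

Lemma L2_scaleD (a : C) (f g : C -> C^o) : L2 f -> L2 g -> L2 (a *: f + g).
Proof.
move=> [rf jf If] [rg jg Ig].
have mr : measurable_fun disc2 (Re \o (a *: f + g) \o toC).
  have -> : Re \o (a *: f + g) \o toC =
    fun p => Re a * (Re \o f \o toC) p - Im a * (Im \o f \o toC) p
             + (Re \o g \o toC) p.
    apply/funext=> p /=; rewrite !fctE /=.
    by case: (a) (f _) (g _) => [x y] [u v] [s t].
  apply: measurable_realfun.measurable_funD => //.
  by apply: measurable_realfun.measurable_funB; apply: measurable_realfun.measurable_funM.
have mi : measurable_fun disc2 (Im \o (a *: f + g) \o toC).
  have -> : Im \o (a *: f + g) \o toC =
    fun p => Re a * (Im \o f \o toC) p + Im a * (Re \o f \o toC) p
             + (Im \o g \o toC) p.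
    apply/funext=> p /=; rewrite !fctE /=.
    case: (a) (f _) (g _) => [x y] [u v] [s t] /=.
    by [].
  apply: measurable_realfun.measurable_funD => //.
  by apply: measurable_realfun.measurable_funD; apply: measurable_realfun.measurable_funM.
split=> //.
pose h := fun p : RR =>
  ((2 * Normc.normc a ^+ 2)%:E * (Normc.normc (f (toC p)) ^+ 2)%:E +
   2%:E * (Normc.normc (g (toC p)) ^+ 2)%:E)%E.
apply: (@le_integrable _ _ _ _ _ measurable_disc2 _ h).
- apply/measurable_realfun.measurable_EFinP; exact: measurable_normc2.
- move=> p _; rewrite /h -!EFinM -EFinD !abse_EFin lee_fin !ger0_norm ?sqr_ge0 ?addr_ge0 ?mulr_ge0 ?sqr_ge0 // ?exprn_ge0 ?normc_nneg //.
  rewrite !fctE /= !sqr_normcE.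
  case: (a) (f _) (g _) => [x y] [u v] [s t] /=.
  have := sqr_ge0 (x * u - y * v - s); have := sqr_ge0 (x * v + y * u - t); nra.
- have I1 := integrableZl measurable_disc2 (2 * Normc.normc a ^+ 2) If.
  have I2 := integrableZl measurable_disc2 2 Ig.
  exact: (integrableD measurable_disc2 I1 I2).
Qed.

Lemma analytic_at_scaleD (a : C) (f g : C -> C^o) (z0 : C) :
  analytic_at f z0 -> analytic_at g z0 -> analytic_at (a *: f + g) z0.
Proof.
move=> [b [r [r0 fb]]] [c [s [s0 gc]]].
exists (fun n => a * b n + c n), (Num.min r s); split; first by rewrite lt_min r0.
move=> z; rewrite lt_min => /andP[zr zs].
have -> : series (fun n => (a * b n + c n) * (z - z0) ^+ n) =
    (fun n => a *: (series (fun n => b n * (z - z0) ^+ n) : nat -> C^o) n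
       + (series (fun n => c n * (z - z0) ^+ n) : nat -> C^o) n).
  apply/funext=> n; rewrite /series /=.
  rewrite [X in _ = X + _]mulr_sumr -big_split /=; apply: eq_bigr => i _.
  by rewrite mulrDl mulrA.
apply: cvgD; last exact: gc.
apply: cvgZr; exact: fb.
Qed.

Lemma bergman_submod_closed : submod_closed bergman_pred.
Proof.
split=> [|a f g].
  rewrite inE; split=> // [z0 _|].
    exists (fun=> 0), 1; split=> // z _.
    have -> : series (fun n => 0 * (z - z0) ^+ n) = cst (0 : C^o).
      by apply/funext=> n; rewrite /series /=; apply: big1 => i _; rewrite mul0r.
    exact: cvg_cst.
  split; [exact: measurable_cst|exact: measurable_cst|].
  rewrite [X in integrable _ _ X](_ : _ = cst 0%E); first exact: integrable0.
  by apply/funext=> p; rewrite sqr_normcE /= expr0n /= addr0.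
rewrite !inE => -[af lf f0] [ag lg g0]; split.
- by move=> z Dz; apply: analytic_at_scaleD; [exact: af|exact: ag].
- exact: L2_scaleD.
- by move=> z nDz; rewrite !fctE f0 // g0 // scaler0 addr0.
Qed.

Lemma normc_leD (x y : C) : Normc.normc (x + y) <= Normc.normc x + Normc.normc y.
Proof.
have := ler_normD x y; rewrite !normc_def => H.
have E (z : C) : Normc.normc z = Num.sqrt (Re z ^+ 2 + Im z ^+ 2) by case: z.
by move: H; rewrite !E -rmorphD /= lecR.
Qed.

Lemma normcX (z : C) n : Normc.normc (z ^+ n) = Normc.normc z ^+ n.
Proof.
elim: n => [|n IH]; first by rewrite !expr0 Normc.normc1.
by rewrite !exprS Normc.normcM IH.
Qed.

Lemma dA_disc2_lty : (dA disc2 < +oo)%E.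
Proof.
rewrite /dA /mscale /= lte_mul_pinfty ?lee_fin //.
pose sq : set (measurableTypeR R) := [set` `[-1, 1]%R].
have msq : measurable sq by exact: measurable_itv.
apply: (@le_lt_trans _ _ ((@lebesgue_measure R \x @lebesgue_measure R)%E (sq `*` sq))).
  apply: le_measure; rewrite ?inE.
  - exact: measurable_disc2.
  - exact: measurableX.
  - move=> [x y]; rewrite /disc2 /disc /=.
    have := @ltr_sqrt R (x ^+ 2 + y ^+ 2) 1 ltr01; rewrite sqrtr1 => -> H.
    by split; rewrite /sq /= in_itv /=; nra.
have sqlt : (@lebesgue_measure R sq < +oo)%E by rewrite /sq lebesgue_measure_itv /= lte_fin; case: ifP => _; rewrite ltry.
rewrite product_measure1E // lte_mul_pinfty ?ge0_fin_numE ?measure_ge0 //.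

Qed.

Definition monomial_fun (n : nat) (z : C) : C^o :=
  if Normc.normc z < 1 then z ^+ n else 0.

Lemma monomial_fun_bergman n : (monomial_fun n : C -> C^o) \in bergman_pred.
Proof.
rewrite inE; split.
- move=> z0 Dz0; exists (fun i => z0 ^+ (n - i) *+ 'C(n, i)), (1 - Normc.normc z0).
  split; first by rewrite subr_gt0.
  move=> z zz0; rewrite /monomial_fun.
  have -> : Normc.normc z < 1.
    rewrite -[z](subrK z0); apply: le_lt_trans (normc_leD _ _) _.
    by rewrite -ltrBrDr.
  apply: cvg_near_cst; exists n.+1 => // m /= nm.
  rewrite /series /= (big_cat_nat _ (n := n.+1)) //= [X in _ + X]big1_seq ?addr0.
    rewrite -[in RHS](subrK z0 z) [in RHS](addrC (z - z0)) exprDn big_mkord.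
    by apply: eq_bigr => i _; rewrite mulrnAl.
  by move=> i /=; rewrite mem_index_iota => /andP[ni _]; rewrite bin_small ?mulr0n ?mul0r.
- have mX m : measurable_fun (setT : set RR) (fun p => Re (toC p ^+ m)) /\
              measurable_fun (setT : set RR) (fun p => Im (toC p ^+ m)).
    elim: m => [|m [IHr IHi]]; first by split; exact: measurable_cst.
    split.
      rewrite (_ : (fun _ => _) = fun p : RR => p.1 * Re (toC p ^+ m) - p.2 * Im (toC p ^+ m)).
        by apply: measurable_realfun.measurable_funB; apply: measurable_realfun.measurable_funM => //.
      by apply/funext => -[x y]; rewrite exprS /=; case: (_ ^+ m).
    rewrite (_ : (fun _ => _) = fun p : RR => p.1 * Im (toC p ^+ m) + p.2 * Re (toC p ^+ m)).
      by apply: measurable_realfun.measurable_funD; apply: measurable_realfun.measurable_funM => //.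
    by apply/funext => -[x y]; rewrite exprS /=; case: (_ ^+ m).
  have [mr mi] := mX n.
  have hr : measurable_fun disc2 (Re \o (monomial_fun n : C -> C^o) \o toC).
    apply: (eq_measurable_fun (fun p => Re (toC p ^+ n))); last exact: measurable_funTS.
    by move=> p; rewrite inE /disc2 /disc /= /monomial_fun => ->.
  have hi : measurable_fun disc2 (Im \o (monomial_fun n : C -> C^o) \o toC).
    apply: (eq_measurable_fun (fun p => Im (toC p ^+ n))); last exact: measurable_funTS.
    by move=> p; rewrite inE /disc2 /disc /= /monomial_fun => ->.
  split=> //.
  apply: (@le_integrable _ _ _ _ _ measurable_disc2 _ (cst 1%E)).
  + apply/measurable_realfun.measurable_EFinP; exact: measurable_normc2.
  + move=> p Dp /=; rewrite normr1 lee_fin ger0_norm ?sqr_ge0 //.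
    rewrite /monomial_fun; move: Dp; rewrite /disc2 /disc /= => Dp; rewrite Dp.
    by rewrite normcX !exprn_ile1 ?exprn_ge0 ?normc_nneg // ltW.
  + apply: measurable_bounded_integrable; [exact: measurable_disc2|exact: dA_disc2_lty| |].
      exact: measurable_cst.
    exact: bounded_cst.
- by move=> z /negP; rewrite /monomial_fun => /negbTE ->.
Qed.

End Disc.

HB.instance Definition _ (R : realType) :=
  GRing.isSubmodClosed.Build R[i] (R[i] -> R[i]^o) (@bergman_pred R)
    (@bergman_submod_closed R).

Record bergman (R : realType) := Bergman {
  bergman_fun :> R[i] -> R[i]^o ;
  _ : bergman_fun \in @bergman_pred R }.

Section BergmanModule.
Variable R : realType.

HB.instance Definition _ := [isSub for @bergman_fun R].
HB.instance Definition _ := [Choice of bergman R by <:].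
HB.instance Definition _ := [SubChoice_isSubLmodule of bergman R by <:].

End BergmanModule.

Section Operators.
Variable R : realType.
Local Notation C := R[i].
Local Notation La2 := (bergman R).
Implicit Types T S : La2 -> La2.

Definition normB (f : La2) : R := normL2 f.

Definition bounded_linear T : Prop :=
  linear T /\ exists M : R, forall f, normB (T f) <= M * normB f.

Definition bounded_below T : Prop :=
  exists2 c : R, 0 < c & forall f, c * normB f <= normB (T f).

Definition invertible T : Prop :=
  exists S, [/\ bounded_linear S, cancel T S & cancel S T].

Definition spectrum T : set C :=
  [set l | ~ invertible (fun f => l *: f - T f)].

Definition approx_point_spectrum T : set C :=
  [set l | ~ bounded_below (fun f => l *: f - T f)].

Definition monomial (n : nat) : La2 := Bergman (monomial_fun_bergman R n).

Definition is_bergman_projection (P : (C -> C^o) -> La2) : Prop :=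
  forall f, L2 f -> forall h : La2, dotL2 (fun z => f z - P f z) h = 0.

(* [xget x0 A] is an element of A, and x0 only if A is empty.  Here orthogonality
   determines P on L2, the only functions it is meant for. *)
Definition bergman_projection : (C -> C^o) -> La2 :=
  xget (fun=> 0) [set P | is_bergman_projection P].

Definition flip (f : C -> C^o) : C -> C^o := fun z => f z^*.

(* meant for an essentially bounded measurable phi, so that phi * f is in L2 *)
Definition little_hankel (phi : C -> C^o) : La2 -> La2 :=
  fun f => bergman_projection (flip (fun z => phi z * f z)).

Definition is_slant (k : nat) (W : La2 -> La2) : Prop :=
  [/\ bounded_linear W,
      forall n, W (monomial (k * n)%N) = monomial n &
      forall n p, (0 < p < k)%N -> W (monomial (k * n + p)%N) = 0].

(* the monomials span a dense subspace, so is_slant k has at most one solution *)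
Definition slant (k : nat) : La2 -> La2 := xget (fun=> 0) [set W | is_slant k W].

Definition slant_little_hankel (k : nat) (phi : C -> C^o) : La2 -> La2 :=
  slant k \o little_hankel phi.

End Operators.

(* Main.v *)
Require Import Defs.
From HB Require Import structures.
From mathcomp Require Import all_boot all_order all_algebra.
From mathcomp Require Import complex.
From mathcomp Require Import all_classical all_reals all_analysis.
From mathcomp Require Import measurable_realfun ring lra.

Set Implicit Arguments.
Unset Strict Implicit.
Unset Printing Implicit Defensive.

Import Order.TTheory GRing.Theory Num.Theory numFieldNormedType.Exports.
Local Open Scope classical_set_scope.
Local Open Scope ring_scope.
Local Open Scope complex_scope.

(** The operator S has finite rank, and for a bounded operator T of finite rank
on an infinite-dimensional space the two spectra agree for a soft reason. An
invertible operator is bounded below by the inverse of the norm of its inverse.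
Conversely let l I - T be bounded below, hence injective. Then l is not 0, since
T has a kernel; and for l <> 0 an injective perturbation of l I by a finite-rank
operator is onto, which reduces to a square matrix (finite_rank_surjective). The
lower bound is then exactly the boundedness of the inverse
(finite_rank_spectrum).

Why S has finite rank: write c_j(f) for <f, z^j> / <z^j, z^j>. Every f in the
Bergman space is the sum of c_j(f) z^j over j <= N plus z^(N+1) K with K
holomorphic on the disc (taylor_coef_remainder). The little Hankel operator
kills the remainder (hankel_ker): since phi is the sum of the conj(z)^i for
i <= N, the inner product of J (phi z^(N+1) K) with h in the Bergman space is
the conjugate of a sum of integrals of conj(z)^i z^(i+1) G with G holomorphic.
Hence S f is the sum of c_j(f) S z^j over j <= N.

So the analytic content is one vanishing statement (integralC_holo0): the
integral of conj(z)^i z^(i+1) G over the disc is 0 for G holomorphic. It is the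
mean value property with a radial weight. It follows from Green's formula: with
u = (|z|^(2i+2) - r^(2i+2)) / (2i+2), the Cauchy-Riemann equations give
  Re (conj(z)^i z^(i+1) G) = d/dx (u Re G) - d/dy (u Im G),
and u vanishes on the circle |z| = r, so integrating along chords gives 0 on
|z| < r; then r tends to 1. The same statement shows that the c_j(f) are the
Taylor coefficients of f at 0, so only local power series enter. The derivative
of G must be continuous for this argument; for a sum of a power series this
comes from an expansion with a uniform quadratic error (analytic_holo_at). *)

(** * Limits and derivatives of complex functions in terms of the modulus *)
Section ComplexNorm.
Variable R : realType.
Local Notation C := R[i].
Local Notation normc := (@Normc.normc R).
Local Notation Re := (@complex.Re R).
Local Notation Im := (@complex.Im R).

Lemma normrE (z : C) : `|z| = (normc z)%:C.
Proof. by rewrite normc_def; case: z. Qed.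

Lemma normc_gt0 (z : C) : (0 < normc z) = (z != 0).
Proof. by rewrite -ltcR -normrE normr_gt0. Qed.

Lemma normc_subC (x y : C) : normc (x - y) = normc (y - x).
Proof. by rewrite -opprB normcN. Qed.

Lemma normc_conj (z : C) : normc z^* = normc z.
Proof. by case: z => x y /=; rewrite sqrrN. Qed.

Lemma normc_real (x : R) : normc x%:C = `|x|.
Proof. by rewrite /= expr0n /= addr0 sqrtr_sqr. Qed.

Lemma abs_Re_le (z : C) : `|Re z| <= normc z.
Proof. by rewrite -lecR -normrE; exact: normc_ge_Re. Qed.

Lemma abs_Im_le (z : C) : `|Im z| <= normc z.
Proof.
case: z => x y /=; rewrite -[`|y|]sqrtr_sqr ler_wsqrtr //.
by rewrite lerDr sqr_ge0.
Qed.

Lemma normc_le_ReIm (z : C) : normc z <= `|Re z| + `|Im z|.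
Proof.
case: z => x y /=; rewrite -[leRHS]ger0_norm ?addr_ge0 // -[leRHS]sqrtr_sqr.
rewrite ler_wsqrtr // sqrrD !real_normK ?num_real // lerD2r lerDl.
by rewrite mulrn_wge0 // mulr_ge0.
Qed.

Lemma posc_gt (e : C) : 0 < e -> exists2 d : R, 0 < d & d%:C = e.
Proof.
by case: e => d b; rewrite ltcE /= => /andP[/eqP -> d0]; exists d.
Qed.

(** The order of the complex numbers only compares numbers with equal imaginary
parts, so a positive radius is a positive real; neighbourhoods, limits and
derivatives can be stated with the real-valued modulus. *)
Lemma near_normc (z0 : C) (P : set C) :
  (\forall z \near (z0 : C^o), P z) <->
  exists2 d : R, 0 < d & forall z, normc (z - z0) < d -> P z.
Proof.
split.
  move=> /nbhs_normP[e /= /posc_gt[d d0 <-] H]; exists d => // z zd.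
  by apply: H; rewrite /ball_ /= distrC normrE ltcR.
move=> [d d0 H]; apply/nbhs_normP; exists d%:C; first by rewrite /= ltcR.
by move=> z; rewrite /ball_ /= distrC normrE ltcR; exact: H.
Qed.

Lemma cvg_normcP (T : Type) (F : set_system T) {FF : Filter F} (f : T -> C^o) (l : C^o) :
  f @ F --> l <-> forall e : R, 0 < e -> \forall x \near F, normc (f x - l) < e.
Proof.
split.
  move=> /cvgrPdist_lt H e e0; have := H e%:C; rewrite ltcR => /(_ e0).
  by apply: filterS => x; rewrite distrC normrE ltcR.
move=> H; apply/cvgrPdist_lt => e /posc_gt[d d0 <-].
by apply: filterS (H d d0) => x; rewrite distrC normrE ltcR.
Qed.

Lemma continuous_normcP (f : C^o -> C^o) (z0 : C) :
  {for z0, continuous f} <->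
  forall e : R, 0 < e -> exists2 d : R, 0 < d &
    forall z, normc (z - z0) < d -> normc (f z - f z0) < e.
Proof.
have P := @cvg_normcP _ _ (nbhs_filter (z0 : C^o)) f (f z0).
split=> [/P H e e0|H]; first by apply/near_normc/H.
by apply/P => e e0; apply/near_normc/H.
Qed.

Lemma is_derive_normcP (f : C^o -> C^o) (z d : C) :
  is_derive (z : C^o) (1 : C^o) f d <->
  forall e : R, 0 < e -> exists2 r : R, 0 < r &
    forall h, normc h < r -> normc (f (z + h) - f z - h * d) <= e * normc h.
Proof.
split.
  move=> fd e e0.
  have /cvg_normcP/(_ e e0) : (fun h : C^o => h^-1 *: (f (h *: (1 : C^o) + z) - f z)) @ (0 : C^o)^' --> (d : C^o).
    by rewrite -(@derive_val _ _ _ _ _ _ _ fd); exact: (@ex_derive _ _ _ _ _ _ _ fd).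
  rewrite near_withinE => /near_normc[r r0 H]; exists r => // h hr.
  have [->|h0] := eqVneq h 0; first by rewrite addr0 subrr mul0r subrr Normc.normc0 mulr0.
  have := H h; rewrite subr0 => /(_ hr h0) /ltW.
  rewrite /GRing.scale /= mulr1 (addrC h z) => le.
  have -> : f (z + h) - f z - h * d = (h^-1 * (f (z + h) - f z) - d) * h.
    by rewrite mulrBl mulrAC mulVf // mul1r (mulrC d).
  by rewrite Normc.normcM ler_wpM2r // normc_nneg.
move=> H.
have cv : (fun h : C^o => h^-1 *: (f (h *: (1 : C^o) + z) - f z)) @ (0 : C^o)^' --> (d : C^o).
  apply/cvg_normcP => e e0; rewrite near_withinE; apply/near_normc.
  have e20 : 0 < e / 2 by rewrite divr_gt0.
  have [r r0 Hr] := H _ e20; exists r => // h; rewrite subr0 => hr h0.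
  have /= := Hr h hr.
  rewrite /GRing.scale /= mulr1 (addrC h z) => le.
  have -> : h^-1 * (f (z + h) - f z) - d = (f (z + h) - f z - h * d) * h^-1.
    by rewrite mulrBl (mulrAC h) divff // mul1r (mulrC _ h^-1).
  have h1 : 0 < normc h by rewrite normc_gt0.
  rewrite Normc.normcM Normc.normcV ltr_pdivrMr //.
  by apply: le_lt_trans le _; rewrite ltr_pM2r //; lra.
apply: DeriveDef; first by apply/cvg_ex; exists d.
exact: cvg_lim cv.
Qed.

End ComplexNorm.

(** * Continuously differentiable functions of a complex variable *)
Section Holomorphic.
Variable R : realType.
Local Notation C := R[i].
Local Notation normc := (@Normc.normc R).
Implicit Types (f g : C^o -> C^o).

(** Continuity of the derivative is part of the notion because the derivatives
of such functions are integrated. *)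
Definition holo_at f (z0 : C^o) := exists g : C^o -> C^o,
  (\forall z \near z0, is_derive (z : C^o) (1 : C^o) f (g z)) /\
  {for z0, continuous g}.

Lemma holo_at_near f1 f2 (z0 : C^o) :
  (\forall z \near z0, f1 z = f2 z) -> holo_at f1 z0 -> holo_at f2 z0.
Proof.
move=> e12 [g [dg cg]]; exists g; split=> //.
have := near_join e12; move: dg; apply: filterS2 => z dz ez.
move: dz; apply: near_eq_is_derive => //; exact: oner_neq0.
Qed.

Lemma holo_at_cst c (z0 : C^o) : holo_at (fun=> c) z0.
Proof.
exists (fun=> 0); split; last by apply: (@cst_continuous C^o C^o).
by apply: (@filterE _ _ (nbhs_filter z0)) => z; exact: is_derive_cst.
Qed.

Lemma holo_at_id (z0 : C^o) : holo_at id z0.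
Proof.
exists (fun=> 1); split; last by apply: (@cst_continuous C^o C^o).
by apply: (@filterE _ _ (nbhs_filter z0)) => z; exact: is_derive_id.
Qed.


Lemma contD f g z : {for z, continuous f} -> {for z, continuous g} ->
  {for z, continuous (fun w => f w + g w)}.
Proof.
move=> cf cg. exact: (@continuousD C C^o C^o f g z cf cg).
Qed.
Lemma contM f g z : {for z, continuous f} -> {for z, continuous g} ->
  {for z, continuous (fun w => f w * g w)}.
Proof.
move=> cf cg. exact: (@continuousM C C^o f g z cf cg).
Qed.
Lemma contN f z : {for z, continuous f} -> {for z, continuous (fun w => - f w)}.
Proof.
move=> cf. exact: (@continuousN C C^o C^o f z cf).
Qed.
Lemma contV f z : f z != 0 -> {for z, continuous f} ->
  {for z, continuous (fun w => (f w)^-1)}.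
Proof.
move=> f0 cf. exact: (@continuousV C C^o f z f0 cf).
Qed.

Lemma holo_at_continuous f (z0 : C^o) : holo_at f z0 -> {for z0, continuous f}.
Proof.
move=> [g [/nbhs_singleton dg _]].
by apply/differentiable_continuous/derivable1_diffP.
Qed.

Lemma holo_atD f1 f2 (z0 : C^o) :
  holo_at f1 z0 -> holo_at f2 z0 -> holo_at (fun z => f1 z + f2 z) z0.
Proof.
move=> [g1 [d1 c1]] [g2 [d2 c2]]; exists (fun z => g1 z + g2 z).
split; last exact: (contD c1 c2).
apply: (@filterS2 _ _ (nbhs_filter z0) _ _ _ _ d1 d2) => z e1 e2.
exact: (@is_deriveD C C^o C^o f1 f2 z 1 _ _ e1 e2).
Qed.

Lemma holo_atM f1 f2 (z0 : C^o) :
  holo_at f1 z0 -> holo_at f2 z0 -> holo_at (fun z => f1 z * f2 z) z0.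
Proof.
move=> h1 h2; have k1 := holo_at_continuous h1; have k2 := holo_at_continuous h2.
move: h1 h2 => [g1 [d1 c1]] [g2 [d2 c2]].
exists (fun z => f1 z * g2 z + f2 z * g1 z); split.
  apply: (@filterS2 _ _ (nbhs_filter z0) _ _ _ _ d1 d2) => z e1 e2.
  exact: (@is_deriveM C C^o f1 f2 z 1 _ _ e1 e2).
exact: (contD (contM k1 c2) (contM k2 c1)).
Qed.

Lemma holo_atX n (z0 : C^o) : holo_at (fun z => z ^+ n) z0.
Proof.
elim: n => [|n IH]; first exact: (holo_at_cst 1).
have -> : (fun z : C^o => z ^+ n.+1) = (fun z => z * z ^+ n).
  by apply/funext => z; rewrite exprS.
exact: (holo_atM (holo_at_id z0) IH).
Qed.

Lemma near_neq0 f z0 : f z0 != 0 -> {for z0, continuous f} -> \forall z \near z0, f z != 0.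
Proof.
move=> f0 /continuous_normcP/(_ (normc (f z0))).
rewrite normc_gt0 => /(_ f0)[d d0 H]; apply/near_normc; exists d => // z /H.
by apply: contraTneq => ->; rewrite sub0r normcN ltxx.
Qed.

Lemma holo_atV f (z0 : C^o) : f z0 != 0 -> holo_at f z0 -> holo_at (fun z => (f z)^-1) z0.
Proof.
move=> f0 h; have k := holo_at_continuous h; move: h => [g [d c]].
have fn0 := near_neq0 f0 k.
exists (fun z => - (f z * f z)^-1 * g z); split.
  apply: (@filterS2 _ _ (nbhs_filter z0) _ _ _ _ fn0 d) => z fz0 dz.
  apply: DeriveDef; first exact: (@derivableV C C^o f z 1 fz0 ex_derive).
  by rewrite (@deriveV C C^o f z 1 fz0 ex_derive) derive_val.
apply: (contM (contN (contV _ (contM k k))) c).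
by rewrite mulf_neq0.
Qed.

(** The reflection f^#(z) = conj (f (conj z)) turns f (conj z), which is what the
flip J produces, into the conjugate of a holomorphic function. *)
Lemma holo_at_sharp f (z0 : C^o) : holo_at f z0^* -> holo_at (fun z => (f z^*)^*) z0.
Proof.
move=> [g [/near_normc[d d0 dg] /continuous_normcP cg]].
exists (fun z => (g z^*)^*); split.
  apply/near_normc; exists d => // z zd; apply/is_derive_normcP => e e0.
  have zd' : normc (z^* - z0^*) < d by rewrite -rmorphB normc_conj.
  have /is_derive_normcP/(_ e e0)[r r0 H] := dg _ zd'.
  exists r => // h hr; have := H h^*; rewrite normc_conj => /(_ hr).
  by rewrite -[X in X <= _ -> _]normc_conj !rmorphB rmorphM rmorphD /= !conjcK.
apply/continuous_normcP => e e0; have [d1 d10 H] := cg e e0.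
exists d1 => // z zd; rewrite -rmorphB normc_conj; apply: H.
by rewrite -rmorphB normc_conj.
Qed.

(** The slope g is automatically continuous: the errors of the expansions from z
to z' and from z' to z add up to (z' - z) (g z' - g z), so this is quadratic. *)
Lemma quadratic_holo_at f g (z0 : C^o) (s c : R) : 0 < s ->
  (forall z z', normc (z - z0) < s -> normc (z' - z0) < s ->
     normc (f z' - f z - (z' - z) * g z) <= c * normc (z' - z) ^+ 2) ->
  holo_at f z0.
Proof.
move=> s0 H.
have c1 : 0 < `|c| + 1 by rewrite ltr_wpDl.
have bnd t x : 0 <= t -> x <= c * t ^+ 2 -> x <= (`|c| + 1) * t ^+ 2.
  move=> t0 /le_trans; apply; rewrite ler_wpM2r ?exprn_ge0 //.
  by rewrite (le_trans (ler_norm c)) // lerDl.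
exists g; split.
  apply/near_normc; exists s => // z zs; apply/is_derive_normcP => e e0.
  exists (Num.min (s - normc (z - z0)) (e / (`|c| + 1))).
    by rewrite lt_min subr_gt0 zs divr_gt0.
  move=> h; rewrite lt_min => /andP[h1 h2].
  have zh : normc (z + h - z0) < s.
    rewrite addrAC; apply: le_lt_trans (normc_leD _ _) _.
    by move: h1; lra.
  have -> : f (z + h) - f z - h * g z = f (z + h) - f z - (z + h - z) * g z.
    by rewrite (addrC z h) addrK.
  apply: le_trans (bnd _ _ (normc_nneg _) (H _ _ zs zh)) _.
  rewrite (addrC z h) addrK expr2 mulrA ler_wpM2r ?normc_nneg //.
  by rewrite mulrC -ler_pdivlMr // ltW.
apply/continuous_normcP => e e0.
exists (Num.min s (e / (2 * (`|c| + 1)))).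
  by rewrite lt_min s0 divr_gt0 // mulr_gt0.
move=> z; rewrite lt_min => /andP[zs ze].
have [->|zz0] := eqVneq z z0; first by rewrite subrr Normc.normc0.
have z0s : normc (z0 - z0) < s by rewrite subrr Normc.normc0.
have zz : 0 < normc (z - z0) by rewrite normc_gt0 subr_eq0.
have b1 := bnd _ _ (normc_nneg _) (H _ _ zs z0s).
have b2 := bnd _ _ (normc_nneg _) (H _ _ z0s zs).
rewrite (normc_subC z0 z) in b1.
have := le_trans (normc_leD _ _) (lerD b2 b1).
have -> : f z - f z0 - (z - z0) * g z0 + (f z0 - f z - (z0 - z) * g z) =
  (z - z0) * (g z - g z0) by ring.
rewrite Normc.normcM -mulr2n -mulr_natl expr2 => le.
have : normc (z - z0) * normc (g z - g z0) <=
    normc (z - z0) * (2 * (`|c| + 1) * normc (z - z0)).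
  by apply: le_trans le _; rewrite le_eqVlt; apply/orP; left; apply/eqP; ring.
rewrite ler_pM2l // => /le_lt_trans; apply.
by rewrite mulrC -ltr_pdivlMr // mulr_gt0.
Qed.

End Holomorphic.

(** * Sums of power series *)
Section PowerSeries.
Variable R : realType.
Local Notation C := R[i].
Local Notation normc := (@Normc.normc R).
Local Notation Re := (@complex.Re R).
Local Notation Im := (@complex.Im R).

Lemma normc_nat n : normc (n%:R : C) = n%:R.
Proof. by rewrite -(rmorph_nat (real_complex R)) normc_real normr_nat. Qed.

(** The factor s ^+ 2 on the left replaces the exponent n - 2 on the right. The
error for n + 1 is a times the error for n plus n b^(n-1) (a - b)^2. *)
Lemma pow_taylor (a b : C) (s : R) n : normc a <= s -> normc b <= s ->
  normc (a ^+ n - b ^+ n - (a - b) * (n%:R * b ^+ n.-1)) * s ^+ 2 <=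
  n%:R ^+ 2 * s ^+ n * normc (a - b) ^+ 2.
Proof.
move=> la lb; have s0 : 0 <= s by exact: le_trans (normc_nneg _) la.
elim: n => [|n IH].
  by rewrite !expr0 !mul0r mulr0 !subrr Normc.normc0 mul0r expr0n /= !mul0r.
set E := a ^+ n - b ^+ n - (a - b) * (n%:R * b ^+ n.-1) in IH.
have -> : a ^+ n.+1 - b ^+ n.+1 - (a - b) * (n.+1%:R * b ^+ n.+1.-1) =
    a * E + n%:R * b ^+ n.-1 * (a - b) ^+ 2.
  rewrite /E /= -natr1; case: n {IH E} => [|n] /=; first by rewrite !expr1 !expr0; ring.
  by rewrite !exprS; ring.
have l1 : normc (a * E) * s ^+ 2 <= n%:R ^+ 2 * s ^+ n.+1 * normc (a - b) ^+ 2.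
  rewrite Normc.normcM -mulrA.
  have -> : n%:R ^+ 2 * s ^+ n.+1 * normc (a - b) ^+ 2 =
      s * (n%:R ^+ 2 * s ^+ n * normc (a - b) ^+ 2) by rewrite (exprS s n); ring.
  by apply: ler_pM => //; rewrite ?mulr_ge0 ?normc_nneg ?exprn_ge0.
have l2 : normc (n%:R * b ^+ n.-1 * (a - b) ^+ 2) * s ^+ 2 <=
    n%:R * s ^+ n.+1 * normc (a - b) ^+ 2.
  rewrite !Normc.normcM normc_nat !normcX.
  have -> : n%:R * normc b ^+ n.-1 * normc (a - b) ^+ 2 * s ^+ 2 =
      n%:R * normc b ^+ n.-1 * s ^+ 2 * normc (a - b) ^+ 2 by ring.
  rewrite ler_wpM2r ?exprn_ge0 ?normc_nneg //.
  case: n {IH E l1} => [|n] /=; first by rewrite !mul0r.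
  have -> : n.+1%:R * s ^+ n.+2 = n.+1%:R * s ^+ n * s ^+ 2 by rewrite !exprS; ring.
  rewrite ler_wpM2r ?exprn_ge0 // ler_wpM2l //.
  by rewrite lerXn2r // ?nnegrE ?normc_nneg.
apply: le_trans (ler_wpM2r (exprn_ge0 2 s0) (normc_leD _ _)) _.
rewrite mulrDl; apply: le_trans (lerD l1 l2) _.
rewrite -!mulrDl ler_wpM2r ?exprn_ge0 ?normc_nneg // ler_wpM2r ?exprn_ge0 //.
rewrite -natr1; have : 0 <= n%:R :> R by []. nra.
Qed.

Lemma normc_lim_le (u : nat -> C^o) (l : C^o) (b : R) :
  u @ \oo --> l -> (forall n, normc (u n) <= b) -> normc l <= b.
Proof.
move=> /cvg_normcP ul ub; apply/ler_addgt0Pr => e /ul[n _ /(_ n (leqnn n))] H.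
rewrite -[l](subrK (u n)); apply: le_trans (normc_leD _ _) _.
by rewrite addrC lerD // normc_subC ltW.
Qed.

Lemma cvg_complex (u : nat -> C^o) (x y : R) :
  (fun n => Re (u n)) @ \oo --> x -> (fun n => Im (u n)) @ \oo --> y ->
  u @ \oo --> (x +i* y : C^o).
Proof.
move=> ux uy; apply/cvg_normcP => e e0; have e2 : 0 < e / 2 by rewrite divr_gt0.
move/cvgrPdist_lt : ux => /(_ _ e2); move/cvgrPdist_lt : uy => /(_ _ e2).
apply: filterS2 => n; case: (u n) => a b /=.
rewrite distrC (distrC x) => h1 h2; have := normc_le_ReIm ((a +i* b) - (x +i* y)) => /=.
by lra.
Qed.

(** Absolute convergence is applied to the real and imaginary parts, where
completeness is that of the reals. *)
Lemma series_dominated_cvg (u : nat -> C) (v : nat -> R) :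
  (forall n, normc (u n) <= v n) -> cvgn (series v) ->
  exists l : C, (series u : nat -> C^o) @ \oo --> (l : C^o).
Proof.
move=> uv cv.
have part (p : {additive C -> R}) : (forall z, `|p z| <= normc z) ->
    cvgn (series (fun n => p (u n))).
  move=> pl; apply: normed_cvg; apply: (series_le_cvg _ _ _ cv) => n /=.
  - exact: normr_ge0.
  - exact: le_trans (normc_nneg _) (uv n).
  - exact: le_trans (pl _) (uv n).
have cR := part Re (@abs_Re_le R); have cI := part Im (@abs_Im_le R).
exists (limn (series (fun n => Re (u n))) +i* limn (series (fun n => Im (u n)))).
apply: cvg_complex.
  rewrite (_ : (fun _ => _) = series (fun n => Re (u n))) //.
  by apply/funext => n; rewrite /series /= raddf_sum.
rewrite (_ : (fun _ => _) = series (fun n => Im (u n))) //.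
by apply/funext => n; rewrite /series /= raddf_sum.
Qed.

Lemma sum_half_le n : \sum_(0 <= k < n) (2^-1 : R) ^+ k <= 2.
Proof.
have -> : \sum_(0 <= k < n) (2^-1 : R) ^+ k = 2 - 2 * 2^-1 ^+ n.
  elim: n => [|n IH]; first by rewrite big_nil expr0; lra.
  by rewrite big_nat_recr //= IH exprS; lra.
have : 0 <= (2^-1 : R) ^+ n by rewrite exprn_ge0 // invr_ge0.
lra.
Qed.

Lemma terms_bounded (u : nat -> C) (l : C) :
  (series u : nat -> C^o) @ \oo --> (l : C^o) ->
  exists2 M : R, 0 < M & forall n, normc (u n) <= M.
Proof.
move=> ul.
have [n0 _ H] := iffLR (cvg_normcP _ _) ul 1 ltr01.
have s0 : 0 <= \sum_(k < n0) normc (u k) by rewrite sumr_ge0 // => k _; exact: normc_nneg.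
exists (2 + \sum_(k < n0) normc (u k)); first by lra.
move=> n; have [n0n|nn0] := leqP n0 n; last first.
  rewrite (bigD1 (Ordinal nn0)) //=.
  have : 0 <= \sum_(i < n0 | i != Ordinal nn0) normc (u i).
    by rewrite sumr_ge0 // => k _; exact: normc_nneg.
  by have := normc_nneg (u n); lra.
have h1 := H n n0n; have h2 := H n.+1 (leqW n0n).
have -> : u n = (series u n.+1 - l) - (series u n - l).
  by rewrite /series /= big_nat_recr //=; ring.
have := normc_leD (series u n.+1 - l) (- (series u n - l)); rewrite normcN.
by move: h1 h2 => /=; lra.
Qed.

(** The terms are bounded at some radius t, so a_n is O(t^-n). At radius s = t/8
both n a_n s^n and n^2 a_n s^n are O(2^-n): the first makes the series of
derivatives converge, the second bounds the quadratic error of the partial sums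
uniformly, and the bound passes to the limit. *)
Lemma analytic_holo_at (f : C^o -> C^o) (z0 : C^o) : analytic_at f z0 -> holo_at f z0.
Proof.
move=> [a [r [r0 H]]].
pose t := r / 2; have t0 : 0 < t by rewrite divr_gt0.
have H1 : normc (z0 + t%:C - z0) < r.
  by rewrite addrC addKr normc_real ger0_norm ?(ltW t0) // /t; lra.
have [M M0 aM] := terms_bounded (H _ H1).
pose s := t / 8; have s0 : 0 < s by rewrite divr_gt0.
have sr : s < r by rewrite /s /t; lra.
have coef_bound n : normc (a n) * s ^+ n <= M * 8^-1 ^+ n.
  rewrite /s exprMn mulrA ler_wpM2r ?exprn_ge0 ?invr_ge0 //.
  have := aM n; rewrite (addrC z0) addrK Normc.normcM normcX normc_real.
  by rewrite ger0_norm ?(ltW t0).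
have n2 n : n%:R <= (2 : R) ^+ n by rewrite -natrX ler_nat ltnW // ltn_expl.
have n21 n : n%:R * 8^-1 ^+ n <= (2^-1 : R) ^+ n.
  have -> : (2^-1 : R) ^+ n = 4 ^+ n * 8^-1 ^+ n by rewrite -exprMn; congr (_ ^+ _); lra.
  rewrite ler_wpM2r ?exprn_ge0 ?invr_ge0 //; apply: le_trans (n2 n) _.
  by rewrite lerXn2r // ?nnegrE //; lra.
have n22 n : n%:R ^+ 2 * 8^-1 ^+ n <= (2^-1 : R) ^+ n.
  have -> : (2^-1 : R) ^+ n = 2 ^+ n * 2 ^+ n * 8^-1 ^+ n.
    by rewrite -!exprMn; congr (_ ^+ _); lra.
  rewrite ler_wpM2r ?exprn_ge0 ?invr_ge0 // expr2.
  by apply: ler_pM.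
pose G (w : C) n := a n * (n%:R * w ^+ n.-1).
have [g gP] : exists g : C -> C, forall z, normc (z - z0) < s ->
    (series (G (z - z0)) : nat -> C^o) @ \oo --> (g z : C^o).
  suff : forall z, exists l : C, normc (z - z0) < s ->
      (series (G (z - z0)) : nat -> C^o) @ \oo --> (l : C^o) by move=> /boolp.choice[g gP]; exists g.
  move=> z; have [zs|] := boolP (normc (z - z0) < s); last by exists 0.
  have [l Hl] : exists l : C, (series (G (z - z0)) : nat -> C^o) @ \oo --> (l : C^o).
    apply: (@series_dominated_cvg _ (geometric (M / s) 2^-1)); last first.
      by apply: is_cvg_geometric_series; rewrite ger0_norm ?invr_ge0 //; lra.
    move=> n; rewrite /G /= !Normc.normcM normc_nat normcX.
    rewrite mulrAC ler_pdivlMr //.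
    apply: (@le_trans _ _ (M * (n%:R * 8^-1 ^+ n))); last by rewrite ler_wpM2l // ltW.
    case: n => [|n]; first by rewrite !mul0r mulr0 !mul0r mulr0.
    apply: (@le_trans _ _ (n.+1%:R * (normc (a n.+1) * s ^+ n.+1))); last first.
      by rewrite [leRHS]mulrCA ler_wpM2l.
    rewrite [leLHS](_ : _ = n.+1%:R * (normc (a n.+1) * (s * normc (z - z0) ^+ n))); last by rewrite /=; ring.
    rewrite ler_wpM2l // ler_wpM2l ?normc_nneg // exprS ler_wpM2l ?(ltW s0) //.
    by rewrite lerXn2r // ?nnegrE ?normc_nneg ?(ltW s0) // ltW.
  by exists l.
apply: (@quadratic_holo_at _ f g z0 s (2 * M / s ^+ 2) s0) => z z' zs zs'.
have c1 := H z (lt_trans zs sr); have c2 := H z' (lt_trans zs' sr).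
have c3 := gP z zs.
pose h := z' - z.
pose u n := series (fun n => a n * (z' - z0) ^+ n) n
   - series (fun n => a n * (z - z0) ^+ n) n - h * series (G (z - z0)) n.
have uc : (u : nat -> C^o) @ \oo --> (f z' - f z - (z' - z) * g z : C^o).
  have c4 := @cvgM C nat \oo eventually_filter (fun=> h) _ h _ (@cvg_cst C^o h nat \oo eventually_filter) c3.
  have c5 := @cvgB C C^o nat \oo eventually_filter _ _ _ _ c2 c1.
  have c6 := @cvgB C C^o nat \oo eventually_filter _ _ _ _ c5 c4.
  exact: c6.
apply: (normc_lim_le uc) => n.
have -> : u n = \sum_(0 <= k < n) a k * ((z' - z0) ^+ k - (z - z0) ^+ k
     - ((z' - z0) - (z - z0)) * (k%:R * (z - z0) ^+ k.-1)).
  rewrite /u /series /= mulr_sumr -!sumrB; apply: eq_bigr => k _.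
  by rewrite /G /h; ring.
apply: (@le_trans _ _ (\sum_(0 <= k < n) (M / s ^+ 2 * normc h ^+ 2) * 2^-1 ^+ k)).
  elim: n => [|n IH]; first by rewrite !big_nil Normc.normc0.
  rewrite !big_nat_recr //=; apply: le_trans (normc_leD _ _) _; apply: lerD => //.
  have := @pow_taylor (z' - z0) (z - z0) s n (ltW zs') (ltW zs).
  have -> : z' - z0 - (z - z0) = h by rewrite /h; ring.
  rewrite Normc.normcM => le.
  rewrite -mulrA (mulrC M) -mulrA ler_pdivlMl ?exprn_gt0 //.
  apply: (@le_trans _ _ (normc (a n) * (n%:R ^+ 2 * s ^+ n * normc h ^+ 2))).
    by rewrite mulrCA ler_wpM2l ?normc_nneg // mulrC.
  rewrite [leLHS](_ : _ = n%:R ^+ 2 * (normc (a n) * s ^+ n) * normc h ^+ 2); last by ring.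
  rewrite [leRHS](_ : _ = M * 2^-1 ^+ n * normc h ^+ 2); last by ring.
  rewrite ler_wpM2r ?exprn_ge0 ?normc_nneg //.
  apply: (@le_trans _ _ (n%:R ^+ 2 * (M * 8^-1 ^+ n))); first by rewrite ler_wpM2l ?exprn_ge0.
  by rewrite mulrCA ler_wpM2l // ltW.
rewrite -mulr_sumr; apply: le_trans (ler_wpM2l _ (sum_half_le n)) _.
  by rewrite !mulr_ge0 ?invr_ge0 ?exprn_ge0 ?normc_nneg ?(ltW s0) ?(ltW M0).
by rewrite /h le_eqVlt; apply/orP; left; apply/eqP; ring.
Qed.

End PowerSeries.

(** * Measurability of continuous functions on the plane *)
Section Plane.
Variable R : realType.
Local Notation RR := (measurableTypeR R * measurableTypeR R)%type.

(** Openness and continuity are spelled out with boxes because RR is a product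
of measurable spaces; plane_contP relates this to the product topology. *)
Definition plane_open (U : set RR) := forall p, U p -> exists2 d : R, 0 < d &
  forall q : RR, `|q.1 - p.1| < d -> `|q.2 - p.2| < d -> U q.

Definition plane_cont (h : RR -> R) (p : RR) := forall e : R, 0 < e -> exists2 d : R, 0 < d &
  forall q : RR, `|q.1 - p.1| < d -> `|q.2 - p.2| < d -> `|h q - h p| < e.

Lemma rat_approx (x e : R) : 0 < e -> exists q : rat, `|ratr q - x| < e.
Proof.
move=> e0; have lt : x - e < x + e by lra.
have [q] := rat_in_itvoo lt; rewrite in_itv /= => /andP[h1 h2].
by exists q; rewrite ltr_norml ltrBrDl h1 /= ltrBlDl.
Qed.

(** An open set is the union of the boxes with rational centre and radius 1/(n+1)
that it contains, and there are countably many of them. *)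
Lemma plane_open_measurable U : plane_open U -> measurable U.
Proof.
move=> oU.
pose box (i : rat * rat * nat) : set RR :=
  (ball (ratr i.1.1 : R) i.2.+1%:R^-1) `*` (ball (ratr i.1.2 : R) i.2.+1%:R^-1).
have tri (a b c d e : R) : e < d / 2 -> `|a - b| < e -> `|a - c| < e -> `|b - c| < d.
  move=> ed ab ac; rewrite -[b](subrK a) -addrA; apply: le_lt_trans (ler_normD _ _) _.
  by rewrite distrC in ab; lra.
have -> : U = \bigcup_(i : rat * rat * nat) (if `[< box i `<=` U >] then box i else set0).
  apply/seteqP; split=> [p Up|p [i _]]; last by case: asboolP => // H /H.
  have [d d0 H] := oU p Up.
  have /ltr_add_invr[n] : 0 < d / 2 by rewrite divr_gt0.
  rewrite add0r => nd.
  have n0 : 0 < n.+1%:R^-1 :> R by rewrite invr_gt0.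
  have [x hx] := rat_approx p.1 n0; have [y hy] := rat_approx p.2 n0.
  exists (x, y, n) => //; case: asboolP => [_|]; first by split; rewrite /ball /=.
  case=> q [] /=; rewrite /ball /= => h1 h2; apply: H.
    exact: tri nd h1 hx.
  exact: tri nd h2 hy.
apply: countable_bigcupT_measurable => // i.
case: asboolP => // _; apply: measurableX; apply: open_measurable; apply: ball_open; rewrite invr_gt0.
Qed.

Lemma plane_cont_measurable (D : set RR) (h : RR -> R) : plane_open D ->
  (forall p, D p -> plane_cont h p) -> measurable_fun D h.
Proof.
move=> oD ch mD; apply: (measurability _ (RGenOInfty.measurableE R)) => //.
move=> _ [_ [a ->] <-]; apply: plane_open_measurable => p [Dp].
rewrite /= in_itv /= andbT => ap.
have [d1 d10 H1] := oD p Dp.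
have [d2 d20 H2] := ch p Dp (h p - a) ltac:(by rewrite subr_gt0).
exists (Num.min d1 d2); first by rewrite lt_min d10.
move=> q; rewrite !lt_min => /andP[q1 q2] /andP[q3 q4]; split; first exact: H1.
rewrite /= in_itv /= andbT.
have := H2 q q2 q4; rewrite ltr_norml; lra.
Qed.

Definition subdisc (r : R) : set RR := [set p | p.1 ^+ 2 + p.2 ^+ 2 < r ^+ 2].

Lemma disc2E : disc2 (R := R) = subdisc 1.
Proof.
apply/seteqP; split=> -[x y]; rewrite /disc2 /disc /subdisc /= expr1n;
  have H := @ltr_sqrt R (x ^+ 2 + y ^+ 2) 1 ltr01; by move: H; rewrite sqrtr1 => ->.
Qed.

Lemma plane_cont_sqr_sum p : plane_cont (fun q => q.1 ^+ 2 + q.2 ^+ 2) p.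
Proof.
move=> e e0; case: p => x y.
(* |u + x| + |v + y| <= M at distance less than 1 *)
pose M := 2 * `|x| + 2 * `|y| + 2.
have M0 : 0 < M by rewrite /M; have := normr_ge0 x; have := normr_ge0 y; lra.
exists (Num.min 1 (e / M)); first by rewrite lt_min ltr01 divr_gt0.
move=> [u v] /=; rewrite !lt_min !ltr_pdivlMr // => /andP[a1 a2] /andP[b1 b2].
have -> : u ^+ 2 + v ^+ 2 - (x ^+ 2 + y ^+ 2) =
  (u - x) * (u - x + 2 * x) + (v - y) * (v - y + 2 * y) by ring.
apply: le_lt_trans (ler_normD _ _) _; rewrite !normrM.
have h1 : `|u - x + 2 * x| <= 1 + 2 * `|x|.
  by apply: le_trans (ler_normD _ _) _; rewrite normrM (ger0_norm (ler0n R 2)); lra.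
have h2 : `|v - y + 2 * y| <= 1 + 2 * `|y|.
  by apply: le_trans (ler_normD _ _) _; rewrite normrM (ger0_norm (ler0n R 2)); lra.
move: a2 b2; rewrite /M.
have := normr_ge0 (u - x); have := normr_ge0 (v - y).
have := normr_ge0 x; have := normr_ge0 y.
move: h1 h2 a1 b1; move: `|u - x| `|v - y| `|x| `|y| `|u - x + 2 * x| `|v - y + 2 * y|.
move=> p q m n s t hs ht _ _ n0 m0 q0 p0 hp hq.
have l1 : p * s <= p * (1 + 2 * m) by rewrite ler_wpM2l.
have l2 : q * t <= q * (1 + 2 * n) by rewrite ler_wpM2l.
have [pq|/ltW qp] := leP p q.
  have : p * (1 + 2 * m) <= q * (1 + 2 * m) by rewrite ler_wpM2r //; lra.
  by lra.
have : q * (1 + 2 * n) <= p * (1 + 2 * n) by rewrite ler_wpM2r //; lra.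
by lra.
Qed.

Lemma plane_open_subdisc r : plane_open (subdisc r).
Proof.
move=> p Dp.
have [d d0 H] := @plane_cont_sqr_sum p (r ^+ 2 - (p.1 ^+ 2 + p.2 ^+ 2)) ltac:(by rewrite subr_gt0).
exists d => // q q1 q2; rewrite /subdisc /=.
have := H q q1 q2; rewrite ltr_norml; lra.
Qed.

End Plane.

(** * Fubini and the fundamental theorem of calculus on a disc *)
Section Green.
Variable R : realType.
Local Notation RR := (measurableTypeR R * measurableTypeR R)%type.
Local Notation mu := (@lebesgue_measure R).
Local Notation area := (mu \x mu)%E.

Lemma integral_derivative0 (F f : R -> R) (s : R) : 0 < s ->
  (forall t, -s <= t <= s -> is_derive t 1 F (f t)) ->
  (forall t, -s <= t <= s -> {for t, continuous f}) ->
  F s = 0 -> F (- s) = 0 ->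
  (\int[mu]_(t in [set` `]-s, s[%R]) (f t)%:E = 0)%E.
Proof.
move=> s0 dF cf Fs FNs.
have ss : -s < s by lra.
have cw : {within `[-s, s], continuous f}.
  apply/continuous_in_subspaceT => t; rewrite inE /= in_itv /=; exact: cf.
have mf : measurable_fun `[-s, s] f.
  exact: subspace_continuous_measurable_fun.
rewrite integral_itv_obnd_cbnd; last first.
  apply/measurable_EFinP; apply: measurable_funS mf => //.
  by move=> x /=; rewrite !in_itv /= => /andP[/ltW -> /ltW ->].
rewrite integral_itv_bndo_bndc; last first.
  apply/measurable_EFinP; apply: measurable_funS mf => //.
  by move=> x /=; rewrite !in_itv /= => /andP[-> /ltW ->].
rewrite (@continuous_FTC2 _ f F) //.
- by rewrite Fs FNs oppe0 adde0.
- have cF t : -s <= t <= s -> {for t, continuous F}.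
    by move=> /dF dt; apply/differentiable_continuous/derivable1_diffP.
  split.
  + move=> x; rewrite in_itv /= => /andP[/ltW x1 /ltW x2].
    by apply: (@ex_derive _ _ _ _ _ _ _ (dF x _)); rewrite x1.
  + by apply: cvg_at_right_filter; apply: cF; lra.
  + by apply: cvg_at_left_filter; apply: cF; lra.
- move=> x; rewrite in_itv /= => /andP[/ltW x1 /ltW x2].
  by rewrite derive1E; apply: (@derive_val _ _ _ _ _ _ _ (dF x _)); rewrite x1.
Qed.

Lemma area_disc2_lty : (area (disc2 (R := R)) < +oo)%E.
Proof.
have H : ((pi^-1)%:E * area (disc2 (R := R)) < +oo)%E := @dA_disc2_lty R.
rewrite ltey; apply: contraTneq H => ->.
by rewrite gt0_muley ?lte_fin ?invr_gt0 ?pi_gt0 // ltxx.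
Qed.

(** Compactness of a square containing the closed disc: near a point outside of
the disc the bound is vacuous, near any other point it follows from
continuity. *)
Lemma plane_cont_bounded (r : R) (h : RR -> R) :
  (forall p, p.1 ^+ 2 + p.2 ^+ 2 <= r ^+ 2 -> plane_cont h p) ->
  exists M, forall p, p.1 ^+ 2 + p.2 ^+ 2 <= r ^+ 2 -> `|h p| <= M.
Proof.
move=> ch; pose H : R * R -> R := h.
pose K : set (R * R) := (`[-`|r|, `|r|] `*` `[-`|r|, `|r|]).
have cK : compact K by apply: compact_setX; exact: segment_compact.
have := iffLR (compact_near_coveringP K) cK.
move=> /(_ R +oo%R (fun M p => p.1 ^+ 2 + p.2 ^+ 2 <= r ^+ 2 -> `|H p| <= M)) ncov.
have [M [_ HM]] : \forall M \near +oo%R, K `<=` (fun p => p.1 ^+ 2 + p.2 ^+ 2 <= r ^+ 2 -> `|H p| <= M).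
  apply: ncov => p Kp.
  have nb (d : R) : 0 < d -> \forall q \near p, `|q.1 - p.1| < d /\ `|q.2 - p.2| < d.
    move=> d0; apply/nbhs_ballP; exists d => // q [] /=.
    by rewrite /ball /= !(distrC p.1) !(distrC p.2).
  have [pr|rp] := leP (p.1 ^+ 2 + p.2 ^+ 2) (r ^+ 2).
    have [d d0 Hd] := ch p pr 1 ltr01.
    exists ([set q : R * R | `|q.1 - p.1| < d /\ `|q.2 - p.2| < d], [set M : R | `|h p| + 1 <= M]).
      split; first exact: nb.
      by apply: nbhs_pinfty_ge; rewrite num_real.
    move=> [q M] [/= [q1 q2] HM] _; apply: le_trans HM.
    have := Hd q q1 q2; rewrite -[H q](subrK (h p)) => hq.
    by apply: le_trans (ler_normD _ _) _; rewrite /H addrC lerD2l ltW.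
  have [d d0 Hd] := @plane_cont_sqr_sum _ p (p.1 ^+ 2 + p.2 ^+ 2 - r ^+ 2) ltac:(by rewrite subr_gt0).
  exists ([set q : R * R | `|q.1 - p.1| < d /\ `|q.2 - p.2| < d], setT).
    by split; [exact: nb|exact: filterT].
  move=> [q M] [/= [q1 q2] _] qr.
  by have := Hd q q1 q2; rewrite /= ltr_norml; lra.
exists (M + 1) => p pr; apply: (HM (M + 1)) => //; first by rewrite ltrDl.
have le (x : R) : x ^+ 2 <= p.1 ^+ 2 + p.2 ^+ 2 -> - `|r| <= x <= `|r|.
  by move=> xp; rewrite -ler_norml -!sqrtr_sqr ler_wsqrtr // (le_trans xp).
split; rewrite /= in_itv /=; apply: le; first by rewrite lerDl sqr_ge0.
by rewrite lerDr sqr_ge0.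
Qed.

(** For c = r^2 - y^2 the domain is the chord at height y of the disc of radius r,
and it is empty when c <= 0. *)
Lemma slice_integral0 (F f : R -> R) (c : R) :
  (forall t, t ^+ 2 <= c -> is_derive t 1 F (f t)) ->
  (forall t, t ^+ 2 <= c -> {for t, continuous f}) ->
  (forall t, t ^+ 2 = c -> F t = 0) ->
  (\int[mu]_(t in [set t | (t ^+ 2 < c)%R]) (f t)%:E = 0)%E.
Proof.
move=> dF cf F0; have [c0|c0] := leP c 0.
  rewrite (_ : [set _ | _] = set0) ?integral_set0 //.
  apply/seteqP; split=> // t /= tc.
  by have := sqr_ge0 t; lra.
have [s s0 ss] : exists2 s : R, 0 < s & s ^+ 2 = c.
  by exists (Num.sqrt c); [rewrite sqrtr_gt0|rewrite sqr_sqrtr // ltW].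
have le t : -s <= t <= s -> t ^+ 2 <= c.
  by rewrite -ler_norml -ss -(real_normK (num_real t)) => ?; rewrite lerXn2r // nnegrE ltW.
rewrite (_ : [set _ | _] = [set` `]-s, s[%R]).
  apply: (@integral_derivative0 F f s s0) => [t /le/dF //|t /le/cf //||]; apply: F0 => //.
  by rewrite sqrrN.
apply/seteqP; split=> t /=; rewrite in_itv /= -ltr_norml -ss -(real_normK (num_real t)).
  by rewrite ltr_pXn2r // nnegrE ltW.
by move=> h; rewrite ltr_pXn2r // nnegrE ltW.
Qed.

Lemma plane_cont_slice1 (h : RR -> R) (x y : R) :
  plane_cont h (x, y) -> {for x, continuous (fun t => h (t, y))}.
Proof.
move=> ch; apply/cvgrPdist_lt => e /ch[d d0 H].
apply/nbhs_ballP; exists d => // t; rewrite /ball /= => td.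
by rewrite distrC; apply: H; rewrite /= ?subrr ?normr0 // distrC.
Qed.

Lemma plane_cont_slice2 (h : RR -> R) (x y : R) :
  plane_cont h (x, y) -> {for y, continuous (fun t => h (x, t))}.
Proof.
move=> ch; apply/cvgrPdist_lt => e /ch[d d0 H].
apply/nbhs_ballP; exists d => // t; rewrite /ball /= => td.
by rewrite distrC; apply: H; rewrite /= ?subrr ?normr0 // distrC.
Qed.

Lemma measurable_subdisc (r : R) : measurable (subdisc r).
Proof. apply: plane_open_measurable; exact: plane_open_subdisc. Qed.

Lemma integrable_subdisc (r : R) (h : RR -> R) : 0 < r < 1 ->
  (forall p, p.1 ^+ 2 + p.2 ^+ 2 <= r ^+ 2 -> plane_cont h p) ->
  area.-integrable (subdisc r) (EFin \o h).
Proof.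
move=> /andP[r0 r1] ch; apply: measurable_bounded_integrable.
- exact: measurable_subdisc.
- apply: le_lt_trans area_disc2_lty; apply: le_measure; rewrite ?inE.
  + exact: measurable_subdisc.
  + exact: measurable_disc2.
  + rewrite disc2E => p; rewrite /subdisc /= => /lt_trans; apply.
    by rewrite ltr_pXn2r // nnegrE ltW.
- apply: plane_cont_measurable => [|p Dp]; first exact: plane_open_subdisc.
  by apply: ch; exact: ltW.
- have [M HM] := plane_cont_bounded ch.
  exists M; split; first by rewrite num_real.
  by move=> x Mx p Dp /=; rewrite (le_trans _ (ltW Mx)) // HM // ltW.
Qed.

(** The horizontal chords of the disc end on the circle, where a vanishes. *)
Lemma integral_dx_subdisc0 (r : R) (a ax : RR -> R) : 0 < r < 1 ->
  (forall p, p.1 ^+ 2 + p.2 ^+ 2 <= r ^+ 2 ->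
     is_derive (p.1 : R) (1 : R) (fun t => a (t, p.2)) (ax p)) ->
  (forall p, p.1 ^+ 2 + p.2 ^+ 2 <= r ^+ 2 -> plane_cont ax p) ->
  (forall p, p.1 ^+ 2 + p.2 ^+ 2 = r ^+ 2 -> a p = 0) ->
  (\int[area]_(p in subdisc r) (ax p)%:E = 0)%E.
Proof.
move=> r01 da ca a0.
have I := integrable_subdisc r01 ca.
rewrite integral_mkcond -integral21_prod_meas1; last first.
  by apply/(integrable_mkcond _ (measurable_subdisc r)).
apply: integral0_eq => y _ /=.
transitivity (\int[mu]_(t in [set t | (t ^+ 2 < r ^+ 2 - y ^+ 2)%R]) (ax (t, y))%:E)%E.
  rewrite [RHS]integral_mkcond; apply: eq_integral => x _.
  rewrite !patchE; congr (if _ then _ else _).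
  by apply/idP/idP; rewrite !inE /subdisc /=; lra.
have le t : t ^+ 2 <= r ^+ 2 - y ^+ 2 -> t ^+ 2 + y ^+ 2 <= r ^+ 2 by lra.
apply: (@slice_integral0 (fun t => a (t, y))).
- by move=> t /le/(da (t, y)).
- by move=> t /le tr; apply: plane_cont_slice1; exact: ca.
- by move=> t tr; apply: a0; rewrite /= tr; lra.
Qed.

Lemma integral_dy_subdisc0 (r : R) (a ay : RR -> R) : 0 < r < 1 ->
  (forall p, p.1 ^+ 2 + p.2 ^+ 2 <= r ^+ 2 ->
     is_derive (p.2 : R) (1 : R) (fun t => a (p.1, t)) (ay p)) ->
  (forall p, p.1 ^+ 2 + p.2 ^+ 2 <= r ^+ 2 -> plane_cont ay p) ->
  (forall p, p.1 ^+ 2 + p.2 ^+ 2 = r ^+ 2 -> a p = 0) ->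
  (\int[area]_(p in subdisc r) (ay p)%:E = 0)%E.
Proof.
move=> r01 da ca a0.
have I := integrable_subdisc r01 ca.
rewrite integral_mkcond -integral12_prod_meas1; last first.
  by apply/(integrable_mkcond _ (measurable_subdisc r)).
apply: integral0_eq => x _ /=.
transitivity (\int[mu]_(t in [set t | (t ^+ 2 < r ^+ 2 - x ^+ 2)%R]) (ay (x, t))%:E)%E.
  rewrite [RHS]integral_mkcond; apply: eq_integral => y _.
  rewrite !patchE; congr (if _ then _ else _).
  by apply/idP/idP; rewrite !inE /subdisc /=; lra.
have le t : t ^+ 2 <= r ^+ 2 - x ^+ 2 -> x ^+ 2 + t ^+ 2 <= r ^+ 2 by lra.
apply: (@slice_integral0 (fun t => a (x, t))).
- by move=> t /le/(da (x, t)).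
- by move=> t /le tr; apply: plane_cont_slice2; exact: ca.
- by move=> t tr; apply: a0; rewrite /= tr; lra.
Qed.

End Green.

(** * The mean value property with a radial weight *)
Section Key.
Variable R : realType.
Local Notation C := R[i].
Local Notation normc := (@Normc.normc R).
Local Notation Re := (@complex.Re R).
Local Notation Im := (@complex.Im R).
Local Notation RR := (measurableTypeR R * measurableTypeR R)%type.
Local Notation mu := (@lebesgue_measure R).
Local Notation area := (mu \x mu)%E.

Lemma is_derive_eps (f : R -> R) (x d : R) :
  (forall e : R, 0 < e -> exists2 r : R, 0 < r &
    forall h, `|h| < r -> `|f (x + h) - f x - h * d| <= e * `|h|) ->
  is_derive x (1 : R) f d.
Proof.
move=> H.
have cv : (fun h : R => h^-1 *: (f (h *: (1 : R) + x) - f x)) @ 0^' --> d.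
  apply/cvgrPdist_le => e e0; rewrite near_withinE.
  have [r r0 Hr] := H _ e0; apply/nbhs_ballP; exists r => // h.
  rewrite /ball /= sub0r normrN => hr h0.
  have /= := Hr h hr; rewrite /GRing.scale /= mulr1 (addrC h x) => le.
  rewrite distrC.
  have -> : h^-1 * (f (x + h) - f x) - d = (f (x + h) - f x - h * d) * h^-1.
    by rewrite mulrBl (mulrAC h) divff // mul1r (mulrC _ h^-1).
  by rewrite normrM normfV ler_pdivrMr // normr_gt0.
apply: DeriveDef; first by apply/cvg_ex; exists d.
exact: cvg_lim cv.
Qed.

Lemma is_derive_slice1 (K : C^o -> C^o) (d : C) (p : RR) :
  is_derive (toC p : C^o) (1 : C^o) K d ->
  is_derive (p.1 : R) (1 : R) (fun t => Re (K (toC (t, p.2)))) (Re d).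
Proof.
move=> /is_derive_normcP H; apply: is_derive_eps => e /H[r r0 {}H].
exists r => // h hr; have := H h%:C; rewrite normc_real => /(_ hr).
apply: le_trans; apply: le_trans (abs_Re_le _).
have -> : toC (p.1 + h, p.2) = toC p + h%:C by rewrite /toC /=; simpc.
clear H; move: (K (_ + _)) (K (toC _)) (d) => [a b] [a' b'] [d1 d2] /=.
by rewrite mul0r subr0.
Qed.

(** Along the imaginary axis K has derivative 'i d, and Im ('i d) = Re d: this and
is_derive_slice1 are the Cauchy-Riemann equations. *)
Lemma is_derive_slice2 (K : C^o -> C^o) (d : C) (p : RR) :
  is_derive (toC p : C^o) (1 : C^o) K d ->
  is_derive (p.2 : R) (1 : R) (fun t => Im (K (toC (p.1, t)))) (Re d).
Proof.
move=> /is_derive_normcP H; apply: is_derive_eps => e /H[r r0 {}H].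
have n0 (h : R) : normc (h *i) = `|h| by rewrite /= expr0n /= add0r sqrtr_sqr.
exists r => // h hr; have := H (h *i); rewrite n0 => /(_ hr).
apply: le_trans; apply: le_trans (abs_Im_le _).
have -> : toC (p.1, p.2 + h) = toC p + h *i by rewrite /toC /=; simpc.
clear H; move: (K (_ + _)) (K (toC _)) (d) => [a b] [a' b'] [d1 d2] /=.
by rewrite mul0r add0r.
Qed.

Definition holo (K : C^o -> C^o) := forall z, disc z -> holo_at K z.

Lemma holo_derive (K : C^o -> C^o) : holo K -> exists g : C^o -> C^o,
  forall z, disc z -> is_derive (z : C^o) (1 : C^o) K (g z) /\ {for z, continuous g}.
Proof.
move=> hK; exists (fun z => 'D_(1 : C^o) K z) => z /hK[g [dg cg]].
have zz := nbhs_singleton dg; split.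
  exact: (DeriveDef (@ex_derive _ _ _ _ _ _ _ zz) erefl).
move: cg dg => /continuous_normcP cg /near_normc[d d0 dg].
apply/continuous_normcP => e /cg[d' d'0 cg'].
exists (Num.min d d'); first by rewrite lt_min d0.
move=> w; rewrite lt_min => /andP[/dg dw /cg'].
by rewrite (@derive_val _ _ _ _ _ _ _ dw) (@derive_val _ _ _ _ _ _ _ zz).
Qed.

Lemma plane_contP (h : R * R -> R) (p : R * R) : plane_cont h p <-> {for p, continuous h}.
Proof.
split=> [ch|/cvgrPdist_lt ch e e0].
  apply/cvgrPdist_lt => e /ch[d d0 H].
  apply: (filterS _ (nbhsx_ballx p d d0)) => q [].
  by rewrite /ball /= => q1 q2; rewrite distrC; apply: H; rewrite distrC.
have /nbhs_ballP[d /= d0 H] := ch e e0; exists d => // q q1 q2.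
by rewrite distrC; apply: H; split; rewrite /ball /= distrC.
Qed.

Lemma plane_cont_comp (g : C^o -> C^o) (phi : C -> R) (p : RR) :
  (forall z w, `|phi z - phi w| <= normc (z - w)) ->
  {for (toC p : C^o), continuous g} -> plane_cont (fun q => phi (g (toC q))) p.
Proof.
move=> lip /continuous_normcP cg e /cg[d d0 H].
exists (d / 2); first by rewrite divr_gt0.
move=> q q1 q2; apply: le_lt_trans (lip _ _) _; apply: H.
apply: le_lt_trans (normc_le_ReIm _) _.
rewrite /toC /=; clear - q1 q2; move: q1 q2; case: p q => [a b] [a' b'] /=; lra.
Qed.

Lemma plane_cont_Re (g : C^o -> C^o) (p : RR) :
  {for (toC p : C^o), continuous g} -> plane_cont (fun q => Re (g (toC q))) p.
Proof. by apply: plane_cont_comp => z w; rewrite -raddfB; exact: abs_Re_le. Qed.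

Lemma plane_cont_Im (g : C^o -> C^o) (p : RR) :
  {for (toC p : C^o), continuous g} -> plane_cont (fun q => Im (g (toC q))) p.
Proof. by apply: plane_cont_comp => z w; rewrite -raddfB; exact: abs_Im_le. Qed.

(** Dominated convergence along the radii 1 - 1/(n+2), with |f| as bound. *)
Lemma exhaust_integral0 (f : RR -> R) :
  area.-integrable (disc2 (R := R)) (EFin \o f) ->
  (forall r, 0 < r < 1 -> (\int[area]_(p in subdisc r) (f p)%:E = 0)%E) ->
  (\int[area]_(p in disc2 (R := R)) (f p)%:E = 0)%E.
Proof.
move=> I f0; set D := disc2 (R := R).
have mD : measurable D by exact: measurable_disc2.
pose r n : R := 1 - n.+2%:R^-1.
have r01 n : 0 < r n < 1.
  have h1 : 0 < n.+2%:R^-1 :> R by rewrite invr_gt0.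
  have h2 : n.+2%:R^-1 < 1 :> R by rewrite invf_lt1 // ltr1n.
  by rewrite /r; move: (n.+2%:R^-1) h1 h2 => x; lra.
pose f_ n := (EFin \o f) \_ (subdisc (r n)).
have mf n : measurable_fun D (f_ n).
  apply/(measurable_restrict _ (measurable_subdisc _) mD).
  apply: measurable_funS (measurable_int area I) => //; exact: subIsetl.
have cf x : D x -> (f_ ^~ x) @ \oo --> (EFin \o f) x.
  rewrite /D disc2E /subdisc /= expr1n => Dx.
  have x0 : 0 <= x.1 ^+ 2 + x.2 ^+ 2 by rewrite addr_ge0 ?sqr_ge0.
  have d0 : 0 < (1 - (x.1 ^+ 2 + x.2 ^+ 2)) / 2 by rewrite divr_gt0 // subr_gt0.
  have [N] := ltr_add_invr d0; rewrite add0r => hN.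
  apply: cvg_near_cst; exists N => // n /= Nn; rewrite /f_ patchE ifT // inE /subdisc /=.
  have : n.+2%:R^-1 <= N.+1%:R^-1 :> R by rewrite lef_pV2 ?posrE ?ltr0n // ler_nat leqW // ltnS.
  have : 0 < n.+2%:R^-1 :> R by rewrite invr_gt0.
  rewrite /r; clear Dx; move: (n.+2%:R^-1) (N.+1%:R^-1) (_ + _) x0 hN {d0} => u v w.
  nra.
have bd x n : D x -> (`|f_ n x| <= `|(EFin \o f) x|)%E.
  by move=> _; rewrite /f_ patchE; case: ifP => // _; rewrite abse0.
have [_ _] := @dominated_convergence _ _ _ area D mD f_ (EFin \o f) (abse \o (EFin \o f)) mf
  (measurable_int area I) (aeW _ cf) (integrable_abse I) (aeW _ bd).
have -> : (fun n => \int[area]_(x in D) f_ n x)%E = cst 0%E.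
  apply/funext => n /=; rewrite /f_ -integral_mkcondr.
  rewrite (_ : D `&` _ = subdisc (r n)); first exact: f0.
  apply/seteqP; split=> [p []//|p Dp]; split=> //.
  move: Dp; rewrite /D disc2E /subdisc /= => /lt_trans; apply.
  by have /andP[? ?] := r01 n; rewrite ltr_pXn2r // nnegrE ltW.
move=> H; have <- := cvg_lim (@ereal_hausdorff R) H.
by rewrite (_ : [sequence _]_n = cst 0%E) ?lim_cst.
Qed.

Lemma plane_contD (f g : RR -> R) p :
  plane_cont f p -> plane_cont g p -> plane_cont (fun q => f q + g q) p.
Proof.
move=> /plane_contP cf /plane_contP cg; apply/plane_contP.
exact: (@continuousD _ _ _ (f : R * R -> R) g p cf cg).
Qed.

Lemma plane_contM (f g : RR -> R) p :
  plane_cont f p -> plane_cont g p -> plane_cont (fun q => f q * g q) p.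
Proof.
move=> /plane_contP cf /plane_contP cg; apply/plane_contP.
exact: (@continuousM _ _ (f : R * R -> R) g p cf cg).
Qed.

Lemma plane_cont_cst (c : R) (p : RR) : plane_cont (fun=> c) p.
Proof. by move=> e e0; exists 1 => // q _ _; rewrite subrr normr0. Qed.

Lemma plane_contX (f : RR -> R) n p : plane_cont f p -> plane_cont (fun q => f q ^+ n) p.
Proof.
move=> cf; elim: n => [|n IH]; first exact: plane_cont_cst.
have -> : (fun q => f q ^+ n.+1) = (fun q => f q * f q ^+ n).
  by apply/funext => q; rewrite exprS.
exact: plane_contM.
Qed.

Lemma plane_cont_fst p : plane_cont (fun q : RR => q.1) p.
Proof. by move=> e e0; exists e. Qed.

Lemma plane_cont_snd p : plane_cont (fun q : RR => q.2) p.
Proof. by move=> e e0; exists e. Qed.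

(** This is the weight u of mean_value_subdisc along a line, y being the square of
the other coordinate. *)
Lemma is_derive_weight (n : nat) (x y c : R) :
  is_derive x (1 : R) (fun t : R => ((t ^+ 2 + y) ^+ n.+1 - c) / (2 * n.+1%:R))
    ((x ^+ 2 + y) ^+ n * x).
Proof.
have n0 : 2 * n.+1%:R != 0 :> R by rewrite mulf_neq0 // pnatr_eq0.
have d2 := @is_deriveX _ _ _ 2 x 1 _ (@is_derive_id R R x 1).
have d3 := is_deriveD d2 (@is_derive_cst R R R y x 1).
have d4 := @is_deriveX _ _ _ n.+1 x 1 _ d3.
have d5 := is_deriveB d4 (@is_derive_cst R R R c x 1).
have d6 := is_deriveZ (2 * n.+1%:R)^-1 d5.
have -> : (fun t : R => ((t ^+ 2 + y) ^+ n.+1 - c) / (2 * n.+1%:R)) =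
    ((2 * n.+1%:R)^-1 *: ((id ^+ 2 + cst y) ^+ n.+1 - cst c)).
  by apply/funext => t; rewrite !fctE mulrC.
apply: is_derive_eq d6 _.
rewrite !fctE /GRing.scale /=; field.
by rewrite addrC natr1 pnatr_eq0.
Qed.

(** The integrand is d/dx (u Re K) - d/dy (u Im K): the terms with K' cancel by the
Cauchy-Riemann equations, and u is normalized so that u_x and u_y are
|z|^(2i) x and |z|^(2i) y. *)
Lemma mean_value_subdisc (K : C^o -> C^o) (i : nat) (r : R) : holo K -> 0 < r < 1 ->
  (\int[area]_(p in subdisc r) (Re ((toC p)^* ^+ i * (toC p) ^+ i.+1 * K (toC p)))%:E = 0)%E.
Proof.
move=> hK r01; have [K' HK] := holo_derive hK.
have disc_in (p : RR) : p.1 ^+ 2 + p.2 ^+ 2 <= r ^+ 2 -> disc (toC p).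
  move=> pr; have : disc2 p; last by [].
  rewrite disc2E /subdisc /= expr1n; apply: le_lt_trans pr _.
  by have /andP[? ?] := r01; rewrite expr_lt1 // ltW.
have n0 : 2 * i.+1%:R != 0 :> R by rewrite mulf_neq0 // pnatr_eq0.
pose q (p : RR) := p.1 ^+ 2 + p.2 ^+ 2.
pose u (p : RR) := (q p ^+ i.+1 - (r ^+ 2) ^+ i.+1) / (2 * i.+1%:R).
pose ax (p : RR) := q p ^+ i * p.1 * Re (K (toC p)) + u p * Re (K' (toC p)).
pose ay (p : RR) := q p ^+ i * p.2 * Im (K (toC p)) + u p * Re (K' (toC p)).
have cq p : plane_cont q p by exact: plane_cont_sqr_sum.
have cu p : plane_cont u p.
  apply: plane_contM; last exact: plane_cont_cst.
  by apply: plane_contD; [exact: plane_contX|exact: plane_cont_cst].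
have KH p : p.1 ^+ 2 + p.2 ^+ 2 <= r ^+ 2 ->
   [/\ is_derive (toC p : C^o) (1 : C^o) K (K' (toC p)),
      {for (toC p : C^o), continuous K} & {for (toC p : C^o), continuous K'}].
  move=> /disc_in Dp; have [d c] := HK _ Dp.
  by split; [exact: d|exact: holo_at_continuous (hK _ Dp)|exact: c].
have cx p : p.1 ^+ 2 + p.2 ^+ 2 <= r ^+ 2 -> plane_cont ax p.
  move=> /KH[_ cK cK']; apply: plane_contD; apply: plane_contM => //; try exact: plane_cont_Re.
  by apply: plane_contM; [exact: plane_contX|exact: plane_cont_fst].
have cy p : p.1 ^+ 2 + p.2 ^+ 2 <= r ^+ 2 -> plane_cont ay p.
  move=> /KH[_ cK cK']; apply: plane_contD; apply: plane_contM => //; [|exact: plane_cont_Im|exact: plane_cont_Re].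
  by apply: plane_contM; [exact: plane_contX|exact: plane_cont_snd].
have Gx : (\int[area]_(p in subdisc r) (ax p)%:E = 0)%E.
  apply: (@integral_dx_subdisc0 _ r (fun p => u p * Re (K (toC p))) ax r01) => p pr.
  - have [dK _ _] := KH p pr.
    have dw := @is_derive_weight i p.1 (p.2 ^+ 2) ((r ^+ 2) ^+ i.+1).
    apply: is_derive_eq (is_deriveM dw (is_derive_slice1 dK)) _.
    by rewrite /ax /GRing.scale /= addrC mulrC.
  - exact: cx.
  - by rewrite /u /q pr subrr !mul0r.
have Gy : (\int[area]_(p in subdisc r) (ay p)%:E = 0)%E.
  apply: (@integral_dy_subdisc0 _ r (fun p => u p * Im (K (toC p))) ay r01) => p pr.
  - have [dK _ _] := KH p pr.
    have dw := @is_derive_weight i p.2 (p.1 ^+ 2) ((r ^+ 2) ^+ i.+1).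
    have -> : (fun t : R => u (p.1, t) * Im (K (toC (p.1, t)))) =
      (fun t : R => ((t ^+ 2 + p.1 ^+ 2) ^+ i.+1 - (r ^+ 2) ^+ i.+1) / (2 * i.+1%:R)) *
      (fun t : R => Im (K (toC (p.1, t)))).
      by apply/funext => t; rewrite /u /q /= (addrC (p.1 ^+ 2)).
    apply: is_derive_eq (is_deriveM dw (is_derive_slice2 dK)) _.
    by rewrite /ay /u /q /GRing.scale /= (addrC (p.2 ^+ 2)); ring.
  - exact: cy.
  - by rewrite /u /q pr subrr !mul0r.
transitivity (\int[area]_(p in subdisc r) ((ax p)%:E - (ay p)%:E))%E.
  apply: eq_integral => p _; rewrite -EFinB; congr (_%:E).
  have -> : (toC p)^* ^+ i * toC p ^+ i.+1 = (q p ^+ i)%:C * toC p.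
    rewrite exprS mulrCA -exprMn mulrC rmorphXn /=; congr (_ ^+ _ * _).
    by rewrite /q /toC /=; simpc; congr (_ +i* _); ring.
  rewrite /ax /ay /toC; case: (K _) => a b; case: (K' _) => a' b' /=; simpc => /=.
  by rewrite -!mulrA; ring.
rewrite integralB ?Gx ?Gy ?sube0 //.
- exact: measurable_subdisc.
- exact: integrable_subdisc.
- exact: integrable_subdisc.
Qed.

End Key.

(** * Complex integrals for the normalized area *)
Section AreaIntegral.
Variable R : realType.
Local Notation C := R[i].
Local Notation normc := (@Normc.normc R).
Local Notation Re := (@complex.Re R).
Local Notation Im := (@complex.Im R).
Local Notation RR := (measurableTypeR R * measurableTypeR R)%type.
Local Notation mu := (@lebesgue_measure R).
Local Notation area := (mu \x mu)%E.
Local Notation D := (disc2 (R := R)).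
Local Notation dA := (@dA R).

Lemma ge0_integral_dA (f : RR -> \bar R) : measurable_fun D f ->
  (forall p, D p -> (0 <= f p)%E) ->
  (\int[dA]_(p in D) f p = (pi^-1)%:E * \int[area]_(p in D) f p)%E.
Proof.
by move=> mf f0; rewrite /dA ge0_integral_mscale //; exact: measurable_disc2.
Qed.

Lemma integrable_dA (f : RR -> \bar R) : dA.-integrable D f -> area.-integrable D f.
Proof.
move=> /integrableP[mf If]; apply/integrableP; split=> //.
move: If; rewrite ge0_integral_dA //; last exact: measurableT_comp.
move=> H; rewrite ltey; apply: contraTneq H => ->.
by rewrite gt0_muley ?lte_fin ?invr_gt0 ?pi_gt0 // ltxx.
Qed.

Lemma integral_dA (f : RR -> \bar R) : dA.-integrable D f ->
  (\int[dA]_(p in D) f p = (pi^-1)%:E * \int[area]_(p in D) f p)%E.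
Proof.
move=> If; have mD := @measurable_disc2 R.
have mf := measurable_int dA If; have Ia := integrable_dA If.
rewrite integralE (ge0_integral_dA (measurable_funepos mf)) //.
rewrite (ge0_integral_dA (measurable_funeneg mf)) //.
have E : (pi^-1)%:E \is a fin_num by [].
rewrite -(muleBr _ _) ?E //; first by rewrite [in RHS]integralE.
apply: fin_num_adde_defl; rewrite fin_numN.
by apply: integrable_fin_num => //; exact: integrable_funeneg.
Qed.

Definition cintegrable (f : C -> C^o) :=
  dA.-integrable D (fun p => (Re (f (toC p)))%:E) /\
  dA.-integrable D (fun p => (Im (f (toC p)))%:E).

Lemma eq_integralC (f g : C -> C^o) : (forall z, disc z -> f z = g z) ->
  integralC f = integralC g.
Proof.
move=> fg; rewrite /integralC; congr (_ +i* _); apply: eq_Rintegral => p;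
  by rewrite inE => Dp; rewrite fg.
Qed.

Lemma eq_cintegrable (f g : C -> C^o) : 
  (forall z, disc z -> f z = g z) -> cintegrable f -> cintegrable g.
Proof.
move=> fg [f1 f2]; split; [move: f1|move: f2]; apply: eq_integrable => //;
  try exact: measurable_disc2; by move=> p; rewrite inE => Dp; rewrite fg.
Qed.

Lemma integralC_conj (f : C -> C^o) : cintegrable f ->
  integralC (fun z => (f z)^*) = (integralC f)^*.
Proof.
move=> [f1 f2]; rewrite /integralC; apply/eqP; rewrite eq_complex /=; apply/andP; split.
  by apply/eqP; apply: eq_Rintegral => p _; case: (f _).
rewrite -mulN1r -RintegralZl //; last exact: measurable_disc2.
by apply/eqP; apply: eq_Rintegral => p _; rewrite mulN1r; case: (f _).
Qed.

Lemma cintegrable_lin (a : C) (f g : C -> C^o) : cintegrable f -> cintegrable g ->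
  cintegrable (fun z => a * f z + g z).
Proof.
have mD := @measurable_disc2 R.
move=> [f1 f2] [g1 g2]; split.
  move: (integrableD mD (integrableB mD (integrableZl mD (Re a) f1) (integrableZl mD (Im a) f2)) g1).
  apply: eq_integrable => // p _ /=; move: (f _) (g _) => [u v] [s t]; case: (a) => x y /=.
  by rewrite -!EFinM -EFinB -EFinD.
move: (integrableD mD (integrableD mD (integrableZl mD (Re a) f2) (integrableZl mD (Im a) f1)) g2).
apply: eq_integrable => // p _ /=; move: (f _) (g _) => [u v] [s t]; case: (a) => x y /=.
by rewrite -!EFinM -!EFinD.
Qed.

Lemma integralC_lin (a : C) (f g : C -> C^o) : cintegrable f -> cintegrable g ->
  integralC (fun z => a * f z + g z) = a * integralC f + integralC g.
Proof.
have mD := @measurable_disc2 R.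
move=> [f1 f2] [g1 g2]; rewrite /integralC.
have ZI k h : dA.-integrable D (fun p => (h p)%:E) -> dA.-integrable D (EFin \o (fun p => k * h p)).
  by move=> /(integrableZl mD k).
transitivity (
  (\int[dA]_(p in D) ((Re a * Re (f (toC p)) - Im a * Im (f (toC p))) + Re (g (toC p)))) +i*
  (\int[dA]_(p in D) ((Re a * Im (f (toC p)) + Im a * Re (f (toC p))) + Im (g (toC p))))).
  congr (_ +i* _); apply: eq_Rintegral => p _; move: (f _) (g _) => [u v] [s t]; case: (a) => x y //=.
have IB := integrableB mD (ZI (Re a) _ f1) (ZI (Im a) _ f2).
have ID := integrableD mD (ZI (Re a) _ f2) (ZI (Im a) _ f1).
have E1 := @RintegralD _ _ _ dA D _ _ mD IB g1.
have E2 := @RintegralD _ _ _ dA D _ _ mD ID g2.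
have E3 := @RintegralB _ _ _ dA D _ _ mD (ZI (Re a) _ f1) (ZI (Im a) _ f2).
have E4 := @RintegralD _ _ _ dA D _ _ mD (ZI (Re a) _ f2) (ZI (Im a) _ f1).
rewrite E1 E2 E3 E4 !RintegralZl //.
by case: (a) => x y; simpc.
Qed.

(** The imaginary part is the real part for - 'i K. *)
Lemma integralC_holo0 (K : C^o -> C^o) (i : nat) : holo K ->
  cintegrable (fun z => z^* ^+ i * z ^+ i.+1 * K z) ->
  integralC (fun z => z^* ^+ i * z ^+ i.+1 * K z) = 0.
Proof.
move=> hK [I1 I2].
have ReK0 (H : C^o -> C^o) : holo H ->
    dA.-integrable D (fun p => (Re ((toC p)^* ^+ i * toC p ^+ i.+1 * H (toC p)))%:E) ->
    \int[dA]_(p in D) Re ((toC p)^* ^+ i * toC p ^+ i.+1 * H (toC p)) = 0.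
  move=> hH I; rewrite /Rintegral integral_dA // exhaust_integral0 ?mule0 //.
    exact: integrable_dA.
  by move=> r r01; exact: mean_value_subdisc.
rewrite /integralC ReK0 //.
have hiK : holo (fun z => (- 'i : C) * K z).
  by move=> z Dz; apply: holo_atM; [exact: holo_at_cst|exact: hK].
have E (p : RR) : Im ((toC p)^* ^+ i * toC p ^+ i.+1 * K (toC p)) =
   Re ((toC p)^* ^+ i * toC p ^+ i.+1 * ((- 'i : C) * K (toC p))).
  rewrite mulrCA; case: (_ * K _) => a b; simpc => /=; ring.
under eq_Rintegral do rewrite E.
rewrite (ReK0 _ hiK) //.
by under eq_fun do rewrite -E.
Qed.

End AreaIntegral.

(** * Square-integrable functions and the flip *)
Section L2Space.
Variable R : realType.
Local Notation C := R[i].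
Local Notation normc := (@Normc.normc R).
Local Notation Re := (@complex.Re R).
Local Notation Im := (@complex.Im R).
Local Notation RR := (measurableTypeR R * measurableTypeR R)%type.
Local Notation mu := (@lebesgue_measure R).
Local Notation area := (mu \x mu)%E.
Local Notation D := (disc2 (R := R)).
Local Notation dA := (@dA R).
Local Notation mD := (@measurable_disc2 R).
Local Notation toC := (@toC R).

Definition cmeasurable (f : C -> C^o) :=
  measurable_fun D (Re \o f \o toC) /\ measurable_fun D (Im \o f \o toC).

Lemma cmeasurableM (f g : C -> C^o) : cmeasurable f -> cmeasurable g ->
  cmeasurable (fun z => f z * g z).
Proof.
move=> [fr fi] [gr gi]; split.
  have -> : Re \o (fun z => f z * g z) \o toC = fun p =>
      (Re \o f \o toC) p * (Re \o g \o toC) p - (Im \o f \o toC) p * (Im \o g \o toC) p.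
    by apply/funext => p /=; move: (f _) (g _) => [a b] [u v].
  by apply: measurable_funB; exact: measurable_funM.
have -> : Im \o (fun z => f z * g z) \o toC = fun p =>
    (Re \o f \o toC) p * (Im \o g \o toC) p + (Im \o f \o toC) p * (Re \o g \o toC) p.
  by apply/funext => p /=; move: (f _) (g _) => [a b] [u v].
by apply: measurable_funD; exact: measurable_funM.
Qed.

Lemma cmeasurable_conj (f : C -> C^o) : cmeasurable f -> cmeasurable (fun z => (f z)^*).
Proof.
move=> [fr fi]; split.
  have -> // : Re \o (fun z => (f z)^* : C^o) \o toC = Re \o f \o toC.
  by apply/funext => p /=; case: (f _).
have -> // : Im \o (fun z => (f z)^* : C^o) \o toC = (fun p => - (Im \o f \o toC) p).
  by apply/funext => p /=; case: (f _).
exact: measurableT_comp.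
Qed.

Lemma holo_cmeasurable (f : C^o -> C^o) : holo f -> cmeasurable f.
Proof.
have oD : plane_open D by rewrite disc2E; exact: plane_open_subdisc.
move=> hf; split; apply: plane_cont_measurable => // p Dp.
  exact: (plane_cont_Re (holo_at_continuous (hf _ Dp))).
exact: (plane_cont_Im (holo_at_continuous (hf _ Dp))).
Qed.

Lemma L2_cmeasurable (f : C -> C^o) : L2 f -> cmeasurable f. Proof. by case. Qed.

Lemma L2_integrable (f : C -> C^o) : L2 f ->
  dA.-integrable D (fun p => (normc (f (toC p)) ^+ 2)%:E).
Proof. by case. Qed.

Lemma cintegrable_dominated (f : C -> C^o) (g : RR -> R) : cmeasurable f ->
  dA.-integrable D (fun p => (g p)%:E) ->
  (forall p, D p -> normc (f (toC p)) <= g p) -> cintegrable f.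
Proof.
move=> [fr fi] Ig fg; split; apply: (le_integrable mD _ _ Ig) => //.
- exact/measurable_EFinP.
- move=> p Dp /=; rewrite lee_fin; apply: le_trans (abs_Re_le _) _.
  exact: le_trans (fg p Dp) (ler_norm _).
- exact/measurable_EFinP.
- move=> p Dp /=; rewrite lee_fin; apply: le_trans (abs_Im_le _) _.
  exact: le_trans (fg p Dp) (ler_norm _).
Qed.

Lemma cintegrable_L2M (f g : C -> C^o) : L2 f -> L2 g -> cintegrable (fun z => f z * g z).
Proof.
move=> Lf Lg.
apply: (@cintegrable_dominated _ (fun p => normc (f (toC p)) ^+ 2 + normc (g (toC p)) ^+ 2)).
- by apply: cmeasurableM; exact: L2_cmeasurable.
- exact: (integrableD mD (L2_integrable Lf) (L2_integrable Lg)).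
- move=> p _; rewrite Normc.normcM.
  have := normc_nneg (f (toC p)); have := normc_nneg (g (toC p)).
  move: (normc _) (normc _) => x y; nra.
Qed.

Lemma L2_conj (f : C -> C^o) : L2 f -> L2 (fun z => (f z)^*).
Proof.
move=> Lf; have [m1 m2] := cmeasurable_conj (L2_cmeasurable Lf); split=> //.
by under eq_fun do rewrite normc_conj; exact: L2_integrable.
Qed.

Lemma L2_mul_bounded (m f : C -> C^o) (B : R) : cmeasurable m ->
  (forall z, disc z -> normc (m z) <= B) -> L2 f -> L2 (fun z => m z * f z).
Proof.
move=> mm mB Lf; have [m1 m2] := cmeasurableM mm (L2_cmeasurable Lf); split=> //.
have I := integrableZl mD (B ^+ 2) (L2_integrable Lf).
apply: (@le_integrable _ _ _ _ _ mD _ _ _ _ I).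
  by apply/measurable_EFinP; exact: (measurable_normc2 m1 m2).
move=> p Dp; rewrite -EFinM !abse_EFin lee_fin !ger0_norm ?mulr_ge0 ?normc_nneg ?(le_trans (normc_nneg _) (mB _ Dp)) //.
rewrite Normc.normcM exprMn ler_wpM2r ?sqr_ge0 //.
by rewrite lerXn2r ?nnegrE ?normc_nneg ?mB // (le_trans (normc_nneg _) (mB _ Dp)).
Qed.

Lemma dotL2_lin (a : C) (f g h : C -> C^o) : L2 f -> L2 g -> L2 h ->
  dotL2 (fun z => a * f z + g z) h = a * dotL2 f h + dotL2 g h.
Proof.
move=> Lf Lg Lh; have Lh' := L2_conj Lh.
rewrite /dotL2 -(integralC_lin a (cintegrable_L2M Lf Lh') (cintegrable_L2M Lg Lh')).
by apply: eq_integralC => z _; rewrite mulrDl mulrA.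
Qed.

Lemma dotL2C (f g : C -> C^o) : L2 f -> L2 g -> dotL2 f g = (dotL2 g f)^*.
Proof.
move=> Lf Lg; rewrite /dotL2 -integralC_conj; last exact: (cintegrable_L2M Lg (L2_conj Lf)).
by apply: eq_integralC => z _; rewrite rmorphM /= conjcK mulrC.
Qed.

Definition reflect2 (p : RR) : RR := (p.1, - p.2).

Lemma measurable_reflect2 : measurable_fun setT reflect2.
Proof.
apply: measurable_fun_pair; first exact: measurable_fst.
by apply: (measurableT_comp (@oppr_measurable R setT)); exact: measurable_snd.
Qed.

(** Both measures agree on rectangles, as the Lebesgue measure of the line is
invariant under the change of sign. *)
Lemma area_reflect2 (A : set RR) : measurable A -> pushforward area reflect2 A = area A.
Proof.
pose mix := isMeasurableFun.Build _ _ _ _ _ measurable_reflect2.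
pose s : {mfun RR >-> RR} := HB.pack reflect2 mix.
move=> mA; apply/esym.
apply: (@product_measure_unique _ _ _ _ _ mu mu (pushforward area s)) => // X Y mX mY.
transitivity (area (X `*` ((-%R : R -> R) @^-1` Y))) => //.
have mY' : measurable ((-%R : R -> R) @^-1` Y).
  by rewrite -[X in measurable X]setTI; exact: (@oppr_measurable R setT measurableT Y mY).
by rewrite product_measure1E //; congr (_ * _)%E; exact: lebesgue_measureN.
Qed.

Lemma L2_flip (f : C -> C^o) : L2 f -> L2 (flip f).
Proof.
move=> [f1 f2 If].
have tr (p : RR) : (toC p)^* = toC (reflect2 p) by [].
have pre : reflect2 @^-1` D = D.
  by rewrite disc2E; apply/seteqP; split=> p; rewrite /subdisc /= sqrrN.
have sD : reflect2 @` D `<=` D by move=> _ [p Dp <-]; rewrite -pre in Dp.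
have mr : measurable_fun D reflect2 by apply: measurable_funTS; exact: measurable_reflect2.
split.
- exact: (measurable_comp mD sD f1 mr).
- exact: (measurable_comp mD sD f2 mr).
have mh := measurable_normc2 f1 f2.
apply/integrableP; split.
  apply/measurable_EFinP; exact: (measurable_comp mD sD mh mr).
have /integrableP[mg] := If; rewrite !ge0_integral_dA //; last 2 first.
  by apply: measurableT_comp => //; apply/measurable_EFinP; exact: (measurable_comp mD sD mh mr).
  by apply: measurableT_comp.
suff -> : (\int[area]_(p in D) `|(normc (f (toC p)) ^+ 2)%:E| =
  \int[area]_(p in D) `|(normc (flip f (toC p)) ^+ 2)%:E|)%E by [].
transitivity (\int[pushforward area reflect2]_(p in D) `|(normc (f (toC p)) ^+ 2)%:E|)%E.
  apply: eq_measure_integral => [|m' A mA _]; first exact: measurable_reflect2.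
  exact: (esym (area_reflect2 mA)).
rewrite ge0_integral_pushforward ?pre //.
- exact: measurable_reflect2.
- exact: measurable_disc2.
- by apply: measurableT_comp.
Qed.

End L2Space.

(** * Definiteness of the norm of the Bergman space *)
Section BergmanSpace.
Variable R : realType.
Local Notation C := R[i].
Local Notation normc := (@Normc.normc R).
Local Notation Re := (@complex.Re R).
Local Notation Im := (@complex.Im R).
Local Notation RR := (measurableTypeR R * measurableTypeR R)%type.
Local Notation mu := (@lebesgue_measure R).
Local Notation area := (mu \x mu)%E.
Local Notation D := (disc2 (R := R)).
Local Notation dA := (@dA R).
Local Notation mD := (@measurable_disc2 R).
Local Notation toC := (@toC R).
Local Notation La2 := (bergman R).

Lemma integral_pos (N : RR -> R) (p : RR) : measurable_fun D N ->
  (forall q, D q -> 0 <= N q) -> plane_cont N p -> D p -> 0 < N p ->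
  (0 < \int[area]_(q in D) (N q)%:E)%E.
Proof.
move=> mN N0 cN Dp Np.
have oD : plane_open D by rewrite disc2E; exact: plane_open_subdisc.
have Np2 : 0 < N p / 2 by rewrite divr_gt0.
have [d1 d10 H1] := oD p Dp; have [d2 d20 H2] := cN _ Np2.
pose d := Num.min d1 d2; have d0 : 0 < d by rewrite lt_min d10.
pose B : set RR := (ball (p.1 : R) d) `*` (ball (p.2 : R) d).
have mb (x : R) : measurable (ball x d).
  by apply: open_measurable; exact: ball_open.
have mB : measurable B by apply: measurableX; exact: mb.
have BH q : B q -> D q /\ N p / 2 <= N q.
  rewrite /B /ball /= !lt_min !(distrC p.1) !(distrC p.2) => -[/andP[a1 a2] /andP[b1 b2]].
  split; first exact: H1.
  by have := H2 q a2 b2; rewrite ltr_norml; lra.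
have mNE : measurable_fun D (EFin \o N) by exact/measurable_EFinP.
have BD : B `<=` D by move=> q /BH[].
apply: (@lt_le_trans _ _ (\int[area]_(q in B) (N q)%:E)%E); last first.
  by apply: ge0_subset_integral => //; exact: mD.
apply: (@lt_le_trans _ _ (\int[area]_(q in B) (N p / 2)%:E)%E); last first.
  apply: ge0_le_integral => //.
  - by move=> q _; rewrite lee_fin ltW.
  - by apply: measurable_funS mNE => //; exact: mD.
  - by move=> q /BH[_]; rewrite lee_fin.
have AB : (0 < (mu \x mu) B)%E.
  have -> : (mu \x mu)%E B = (mu (ball (p.1 : R) d) * mu (ball (p.2 : R) d))%E.
    by apply: product_measure1E; exact: mb.
  rewrite (lebesgue_measure_ball (p.1 : R) (ltW d0)) (lebesgue_measure_ball (p.2 : R) (ltW d0)).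
  by apply: mule_gt0; rewrite lte_fin mulrn_wgt0.
by rewrite integral_cst //; apply: mule_gt0; [rewrite lte_fin|exact: AB].
Qed.

Lemma normL2_ge0 (f : C -> C^o) : 0 <= normL2 f.
Proof. exact: sqrtr_ge0. Qed.

(** A value f z <> 0 keeps |f|^2 away from 0 on a box around z, by continuity, and
a box has positive area. *)
Lemma normL2_eq0 (f : C^o -> C^o) : L2 f -> holo f -> normL2 f = 0 ->
  forall z, disc z -> f z = 0.
Proof.
move=> Lf hf nf z Dz; apply/eqP; apply: contraTT isT => fz.
pose N (p : RR) := normc (f (toC p)) ^+ 2.
have NE (p : RR) : Re (f (toC p) * (f (toC p))^*) = N p.
  by rewrite /N sqr_normcE; case: (f _) => a b /=; simpc => /=; ring.
have IN : dA.-integrable D (fun p => (N p)%:E) by exact: L2_integrable.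
have [f1 f2] := L2_cmeasurable Lf.
have zE : z = toC (complex.Re z, complex.Im z) by case: z {Dz fz}.
have cf := holo_at_continuous (hf _ Dz).
have cN : plane_cont N (complex.Re z, complex.Im z).
  have -> : N = fun p => Re (f (toC p)) ^+ 2 + Im (f (toC p)) ^+ 2.
    by apply/funext => p; rewrite /N sqr_normcE.
  by rewrite zE in cf; apply: plane_contD; apply: plane_contX; [exact: plane_cont_Re|exact: plane_cont_Im].
have : (0 < \int[area]_(q in D) (N q)%:E)%E.
  apply: (@integral_pos N (complex.Re z, complex.Im z)) => //.
  - exact: measurable_normc2.
  - by move=> q _; rewrite /N sqr_ge0.
  - by rewrite /D /disc2 /= -zE.
  - by rewrite /N -zE exprn_gt0 // normc_gt0.
move: nf; rewrite /normL2 /dotL2 /integralC /=.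
under eq_Rintegral do rewrite NE.
move=> /eqP; rewrite sqrtr_eq0 => le0 gt0.
have fin : (\int[dA]_(q in D) (N q)%:E)%E \is a fin_num by apply: integrable_fin_num => //; exact: mD.
have : (0 < \int[dA]_(q in D) (N q)%:E)%E.
  by rewrite integral_dA // mule_gt0 // lte_fin invr_gt0 pi_gt0.
by rewrite -(fineK fin) lte_fin ltNge le0.
Qed.

Lemma bergmanP (f : La2) : [/\ forall z, disc z -> analytic_at f z, L2 f
  & forall z, ~ disc z -> f z = 0].
Proof. by case: f => f /=; rewrite inE. Qed.

Lemma bergman_holo (f : La2) : holo f.
Proof. by move=> z Dz; apply: analytic_holo_at; have [af _ _] := bergmanP f; exact: af. Qed.

Lemma bergman_L2 (f : La2) : L2 f. Proof. by have [] := bergmanP f. Qed.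

Lemma bergman_ext (f g : La2) : (forall z, disc z -> f z = g z) -> f = g.
Proof.
move=> fg; apply: val_inj; apply/funext => z /=.
have [Dz|nDz] := pselect (disc z); first exact: fg.
by have [_ _ ->//] := bergmanP f; have [_ _ ->] := bergmanP g.
Qed.

Lemma normB_eq0 (f : La2) : normB f = 0 -> f = 0.
Proof.
move=> nf; apply: bergman_ext => z Dz.
by rewrite (normL2_eq0 (bergman_L2 f) (@bergman_holo f) nf Dz).
Qed.

Lemma dotL2_eq0 (f : La2) : dotL2 f f = 0 -> f = 0.
Proof. by move=> ff; apply: normB_eq0; rewrite /normB /normL2 ff sqrtr0. Qed.

Lemma bergman_linE (a : C) (f g : La2) z : (a *: f + g : La2) z = a * f z + g z.
Proof. by []. Qed.

Lemma dotL2_linB (a : C) (f g : La2) (h : C -> C^o) : L2 h ->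
  dotL2 (a *: f + g : La2) h = a * dotL2 f h + dotL2 g h.
Proof.
by move=> Lh; rewrite -(dotL2_lin a (bergman_L2 f) (bergman_L2 g) Lh).
Qed.

End BergmanSpace.

(** * Taylor expansion at the origin and orthogonality of monomials *)
Lemma double_eq0 (V : zmodType) (x : V) : x = x + x -> x = 0.
Proof. by move/eqP; rewrite -{1}[x]addr0 (inj_eq (addrI x)) eq_sym => /eqP. Qed.

Section Taylor.
Variable R : realType.
Local Notation C := R[i].
Local Notation normc := (@Normc.normc R).
Local Notation La2 := (bergman R).
Local Notation mono := (@monomial R).

Lemma disc0 : disc (0 : C).
Proof. by rewrite /disc /mkset Normc.normc0. Qed.

Lemma cvg_shift_cst (u : nat -> C^o) (c l : C^o) :
  u @ \oo --> l -> (forall n, u n.+1 = c) -> c = l.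
Proof.
move=> /cvg_normcP ul uc; apply/eqP; rewrite -subr_eq0; apply: contraT.
rewrite -normc_gt0 => /ul[n _ /(_ n.+1 (leqnSn n))]; rewrite uc => H.
by have := lt_irreflexive (normc (c - l)); rewrite H.
Qed.

(** At 0 the quotient is the power series with shifted coefficients; elsewhere it
is a product of holomorphic functions. *)
Lemma divided_difference (g : C^o -> C^o) : analytic_at g 0 -> holo g ->
  exists2 K : C^o -> C^o, analytic_at K 0 /\ holo K & forall z, g z = g 0 + z * K z.
Proof.
move=> [b [r [r0 gb]]] hg.
have g0 : g 0 = b 0%N.
  have h0 : normc ((0 : C) - 0) < r by rewrite subrr Normc.normc0.
  apply/esym; apply: (cvg_shift_cst (gb 0 h0)) => n.
  rewrite /series /= big_nat_recl //= expr0 mulr1 big1 ?addr0 // => i _.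
  by rewrite subrr exprS mul0r mulr0.
(* the value at 0 is the limit of the quotient *)
pose K (z : C^o) : C^o := if z == 0 then b 1%N else z^-1 * (g z - g 0).
have aK : analytic_at K 0.
  exists (fun n => b n.+1), r; split; first exact: r0.
  move=> z zr.
  have [z0|z0] := eqVneq z 0.
    rewrite /K z0 eqxx; apply: cvg_near_cst; exists 1%N => // -[//|n] _.
    rewrite /series /= big_nat_recl //= expr0 mulr1 big1 ?addr0 // => i _.
    by rewrite subrr exprS mul0r mulr0.
  rewrite /K (negbTE z0); apply/cvg_normcP => e e0.
  have ez : 0 < e * normc z by rewrite mulr_gt0 // normc_gt0.
  have /cvg_normcP/(_ _ ez)[N _ HN] := gb z zr.
  exists N => // n /= Nn; have /= := HN n.+1 (leqW Nn).
  rewrite {1}/series /= big_nat_recl //= expr0 mulr1 -g0.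
  have -> : \sum_(0 <= i < n) b i.+1 * (z - 0) ^+ i.+1 =
      z * series (fun k => b k.+1 * (z - 0) ^+ k) n.
    by rewrite /series /= mulr_sumr; apply: eq_bigr => i _; rewrite subr0 exprS mulrCA.
  move: (series _ n) => s le.
  have -> : s - z^-1 * (g z - g 0) = z^-1 * (g 0 + z * s - g z).
    by rewrite -[s in LHS](mulKf z0) -mulrBr; congr (_ * _); ring.
  rewrite Normc.normcM Normc.normcV mulrC ltr_pdivrMr // normc_gt0 //.
exists K; last first.
  move=> z; rewrite /K; have [->|z0] := eqVneq z 0; first by rewrite mul0r addr0.
  by rewrite mulrA divff // mul1r addrC subrK.
split=> // z Dz; have [->|z0] := eqVneq z 0; first exact: analytic_holo_at.
have hz := holo_atM (holo_atV z0 (holo_at_id z)) (holo_atD (hg z Dz) (holo_at_cst (- g 0) z)).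
apply: holo_at_near hz; apply/near_normc; exists (normc z); first by rewrite normc_gt0.
move=> w wz; rewrite /K ifF //; apply: contraTF wz => /eqP ->.
by rewrite sub0r normcN ltxx.
Qed.

Lemma taylor_remainder (f : La2) n : exists a : nat -> C, exists2 K : C^o -> C^o, holo K &
  forall z, f z = \sum_(j < n) a j * z ^+ j + z ^+ n * K z.
Proof.
suff [a [K [_ hK] H]] : exists a : nat -> C, exists2 K : C^o -> C^o, analytic_at K 0 /\ holo K &
    forall z, f z = \sum_(j < n) a j * z ^+ j + z ^+ n * K z by exists a, K.
elim: n => [|n [a [K [aK hK] H]]].
  exists (fun=> 0), f; first by split; [have [af _ _] := bergmanP f; exact: af disc0|exact: bergman_holo].
  by move=> z; rewrite big_ord0 add0r expr0 mul1r.
have [K' K'P K'E] := divided_difference aK hK.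
(* K(z) = K(0) + z K'(z), so K(0) is the next coefficient *)
exists (fun j => if j == n then K 0 else a j), K' => // z.
rewrite big_ord_recr /= eqxx H K'E exprSr mulrDr addrA mulrA (mulrC (K 0)); congr (_ + _ + _).
by apply: eq_bigr => j _; rewrite ifF // ltn_eqF.
Qed.

(** The j-th Taylor coefficient at 0 (taylor_coef_remainder), in a form that is
visibly linear in f. *)
Definition taylor_coef (j : nat) (f : La2) : C := dotL2 f (mono j) / dotL2 (mono j) (mono j).

Lemma monoE n z : disc z -> mono n z = z ^+ n.
Proof. by rewrite /= /monomial_fun /disc /= => ->. Qed.

Lemma holo_sharp (f : C^o -> C^o) : holo f -> holo (fun z => (f z^*)^*).
Proof.
by move=> hf z Dz; apply: holo_at_sharp; apply: hf; rewrite /disc /= normc_conj.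
Qed.

Lemma holoM (f g : C^o -> C^o) : holo f -> holo g -> holo (fun z => f z * g z).
Proof. by move=> hf hg z Dz; apply: holo_atM; [exact: hf|exact: hg]. Qed.

Lemma holoX n : holo (fun z : C^o => z ^+ n).
Proof. by move=> z _; exact: holo_atX. Qed.

Lemma mono_neq0 n : mono n <> 0.
Proof.
(* any nonzero point of the disc would do *)
move=> m0; have h : disc (2^-1%:C : C).
  by rewrite /disc /= expr0n /= addr0 sqrtr_sqr ger0_norm ?invr_ge0 // invf_lt1 // ltr1n.
have := monoE n h; rewrite m0 => /esym/eqP; rewrite expf_eq0 => /andP[_].
by rewrite -(rmorph0 (real_complex R)) (inj_eq (@complexI R)) invr_eq0 pnatr_eq0.
Qed.

(** The integrand is conj(z)^m z^(m+1) times a holomorphic function, as m < n. *)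
Lemma dotL2_mono_vanish (g : La2) (K : C^o -> C^o) m n : (m < n)%N -> holo K ->
  (forall z, disc z -> g z = z ^+ n * K z) -> dotL2 g (mono m) = 0.
Proof.
move=> mn hK gE.
have E z : disc z -> g z * (mono m z)^* = z^* ^+ m * z ^+ m.+1 * (z ^+ (n - m.+1) * K z).
  by move=> Dz; rewrite gE // monoE // rmorphXn /= -{1}(subnKC mn) exprD; ring.
rewrite /dotL2 (eq_integralC E); apply: integralC_holo0; first exact: (holoM (holoX _) hK).
by apply: eq_cintegrable E _; apply: cintegrable_L2M; [exact: bergman_L2|exact/L2_conj/bergman_L2].
Qed.

Lemma dotL2_mono_orth m n : m != n -> dotL2 (mono n) (mono m) = 0.
Proof.
have lt m' n' : (m' < n')%N -> dotL2 (mono n') (mono m') = 0.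
  move=> h; apply: (dotL2_mono_vanish h (holoX 0)) => z Dz.
  by rewrite monoE // expr0 mulr1.
case: ltngtP => // h _; first exact: lt.
by rewrite dotL2C ?lt ?conjc0 //; exact: bergman_L2.
Qed.

Lemma taylor_coef_lin j (a : C) (f g : La2) :
  taylor_coef j (a *: f + g) = a * taylor_coef j f + taylor_coef j g.
Proof. by rewrite /taylor_coef dotL2_linB ?mulrDl ?mulrA //; exact: bergman_L2. Qed.

Lemma taylor_coef0 j : taylor_coef j 0 = 0.
Proof.
apply: double_eq0.
by have := taylor_coef_lin j 1 0 0; rewrite scale1r addr0 mul1r.
Qed.

Lemma taylor_coef_sum j n (a : 'I_n -> C) (e : 'I_n -> La2) :
  taylor_coef j (\sum_(i < n) a i *: e i) = \sum_(i < n) a i * taylor_coef j (e i).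
Proof.
elim/big_rec2: _ => [|i x y _ <-]; first exact: taylor_coef0.
by rewrite taylor_coef_lin.
Qed.

(** The inner product with z^j, for j < n, sees neither the remainder
(dotL2_mono_vanish) nor the other monomials. *)
Lemma taylor_coef_remainder (f : La2) n : exists2 K : C^o -> C^o, holo K &
  forall z, f z = \sum_(j < n) taylor_coef j f * z ^+ j + z ^+ n * K z.
Proof.
have [a [K hK fE]] := taylor_remainder f n; exists K => // z.
rewrite fE; congr (_ + _); apply: eq_bigr => j _; congr (_ * _); rewrite {z}.
pose r : La2 := f - \sum_(i < n) a i *: mono i.
have sumE z : disc z -> (\sum_(i < n) a i *: mono i : La2) z = \sum_(i < n) a i * z ^+ i.
  move=> Dz; elim: n {r fE j} => [|n IH]; first by rewrite !big_ord0.
  rewrite !big_ord_recr /= -IH -monoE //.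
have rE z : disc z -> r z = z ^+ n * K z.
  by move=> Dz; rewrite -[LHS]/(f z - (\sum_(i < n) a i *: mono i : La2) z) sumE // fE addrC addKr.
have c0 : taylor_coef j r = 0.
  by rewrite /taylor_coef (dotL2_mono_vanish (ltn_ord j) hK rE) mul0r.
have dj : dotL2 (mono j) (mono j) != 0.
  by apply/eqP => /dotL2_eq0; exact: mono_neq0.
have fr : f = 1 *: r + \sum_(i < n) a i *: mono i by rewrite scale1r subrK.
rewrite fr taylor_coef_lin c0 mulr0 add0r taylor_coef_sum (bigD1 j) //= big1 ?addr0.
  by rewrite /taylor_coef divff // mulr1.
by move=> i ij; rewrite /taylor_coef dotL2_mono_orth ?mul0r ?mulr0 // eq_sym.
Qed.

End Taylor.

(** * Spectra of operators of finite rank *)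
Section FiniteRankSpectrum.
Variable R : realType.
Local Notation C := R[i].
Local Notation La2 := (bergman R).

Lemma normB_ge0 (f : La2) : 0 <= normB f.
Proof. exact: normL2_ge0. Qed.

Lemma normB0 : normB (0 : La2) = 0.
Proof.
rewrite /normB /normL2 /dotL2 (@eq_integralC _ _ (fun=> 0)); last by move=> z _; rewrite mul0r.
by rewrite /integralC /= /Rintegral integral0 sqrtr0.
Qed.

Lemma invertible_bounded_below (T : La2 -> La2) : invertible T -> bounded_below T.
Proof.
move=> [S [[_ [M HM]] TK _]]; exists (Num.max M 1)^-1.
  by rewrite invr_gt0 lt_max ltr01 orbT.
move=> f; rewrite ler_pdivrMl ?lt_max ?ltr01 ?orbT //.
rewrite -{1}(TK f); apply: le_trans (HM _) _.
by rewrite ler_wpM2r ?normB_ge0 // le_max lexx.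
Qed.

Lemma bounded_below_ker (T : La2 -> La2) f : bounded_below T -> T f = 0 -> f = 0.
Proof.
move=> [c c0 H] Tf; have := H f; rewrite Tf normB0 pmulr_rle0 // => h.
by apply: normB_eq0; apply/eqP; rewrite eq_le h normB_ge0.
Qed.

(** The lower bound for T is the bound for the norm of its inverse. *)
Lemma surjective_invertible (T : La2 -> La2) : linear T -> bounded_below T ->
  (forall g, exists f, T f = g) -> invertible T.
Proof.
move=> lT bT /boolp.choice[S SK].
have injT f g : T f = T g -> f = g.
  move=> fg; apply/eqP; rewrite -subr_eq0; apply/eqP; apply: (bounded_below_ker bT).
  by rewrite addrC -scaleN1r lT fg scaleN1r addNr.
exists S; split=> //; last by move=> f; apply: injT; rewrite SK.
split; first by move=> a f g; apply: injT; rewrite lT !SK.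
have [c c0 H] := bT; exists c^-1 => f.
by rewrite ler_pdivlMl //; have := H (S f); rewrite SK.
Qed.

(** A solution of l f - T f = g is l^-1 (g + sum_j x_j e_j) as soon as x solves a
linear system with matrix A. If x A = 0, then f = sum_j x_j e_j satisfies
l f - T f = 0, hence f = 0 and l x_i = c_i(f) = 0; so A is invertible. *)
Lemma finite_rank_surjective n (c : 'I_n -> La2 -> C) (e : 'I_n -> La2) (l : C) :
  (forall i a f g, c i (a *: f + g) = a * c i f + c i g) -> l != 0 ->
  (forall f, l *: f - \sum_(i < n) c i f *: e i = 0 -> f = 0) ->
  forall g, exists f, l *: f - \sum_(i < n) c i f *: e i = g.
Proof.
move=> cl l0 inj g.
have c0 i : c i 0 = 0.
  by apply: double_eq0; have := cl i 1 0 0; rewrite scale1r addr0 mul1r.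
have cs i (x : 'I_n -> C) : c i (\sum_(j < n) x j *: e j) = \sum_(j < n) x j * c i (e j).
  elim/big_rec2: _ => [|j u v _ <-]; first exact: c0.
  by rewrite cl.
pose A : 'M[C]_n := l%:M - \matrix_(j, i) c i (e j).
have AE (x : 'rV[C]_n) i : (x *m A) 0 i = l * x 0 i - c i (\sum_j x 0 j *: e j).
  rewrite mulmxBr mul_mx_scalar !mxE cs; congr (_ - _).
  by apply: eq_bigr => j _; rewrite mxE.
have Au : A \in unitmx.
  rewrite -row_free_unit -kermx_eq0; apply/rowV0P => x /sub_kermxP xA.
  have cx i : c i (\sum_j x 0 j *: e j) = l * x 0 i.
    by apply/esym/eqP; rewrite -subr_eq0 -AE xA mxE.
  have f0 : \sum_j x 0 j *: e j = 0.
    apply: inj; apply/eqP; rewrite subr_eq0; apply/eqP.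
    by rewrite scaler_sumr; apply: eq_bigr => i _; rewrite cx scalerA.
  apply/rowP => i; have := cx i; rewrite f0 c0 mxE => /esym/eqP.
  by rewrite mulf_eq0 (negbTE l0) => /eqP.
pose x : 'rV[C]_n := (\row_i c i g) *m invmx A.
exists (l^-1 *: (\sum_j x 0 j *: e j + g)).
have xA : x *m A = \row_i c i g by rewrite mulmxKV.
have cf i : c i (l^-1 *: (\sum_j x 0 j *: e j + g)) = x 0 i.
  rewrite -[l^-1 *: _]addr0 cl c0 addr0 -[\sum_j _]scale1r cl mul1r.
  have := AE x i; rewrite xA mxE => ->.
  by rewrite addrC subrK mulKf.
rewrite scalerA divff // scale1r.
rewrite [X in _ - X](eq_bigr (fun j => x 0 j *: e j)); last by move=> i _; rewrite cf.
by rewrite addrC addKr.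
Qed.

(** The vector f0 in the kernel excludes l = 0: there T would be injective. *)
Lemma finite_rank_spectrum n (c : 'I_n -> La2 -> C) (T : La2 -> La2) (e : 'I_n -> La2) f0 :
  (forall i a f g, c i (a *: f + g) = a * c i f + c i g) ->
  (forall f, T f = \sum_(i < n) c i f *: e i) -> f0 <> 0 -> (forall i, c i f0 = 0) ->
  approx_point_spectrum T = spectrum T.
Proof.
move=> cl TE f00 cf0; apply/seteqP; split=> l /= Hl; apply: contra_not Hl.
  exact: invertible_bounded_below.
move=> bb.
have Tf0 : T f0 = 0 by rewrite TE big1 // => i _; rewrite cf0 scale0r.
have l0 : l != 0.
  apply/eqP => l0; apply: f00; apply: (bounded_below_ker bb).
  by rewrite l0 scale0r Tf0 subr0.
have lT : linear (fun f => l *: f - T f).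
  move=> a f g; rewrite !TE.
  have -> : \sum_(i < n) c i (a *: f + g) *: e i =
      a *: (\sum_(i < n) c i f *: e i) + \sum_(i < n) c i g *: e i.
    rewrite scaler_sumr -big_split /=; apply: eq_bigr => i _.
    by rewrite cl scalerDl scalerA.
  by rewrite scalerDr scalerBr !scalerA (mulrC l) opprD addrACA.
apply: surjective_invertible => // g.
have [f|f <-] := @finite_rank_surjective n c e l cl l0 _ g.
  by rewrite -TE; exact: (bounded_below_ker bb).
by exists f; rewrite TE.
Qed.

End FiniteRankSpectrum.

(** * The little Hankel operator has finite rank *)
Section Hankel.
Variable R : realType.
Local Notation C := R[i].
Local Notation normc := (@Normc.normc R).
Local Notation La2 := (bergman R).
Variable N : nat.

Definition conj_geometric (z : C) : C^o := \sum_(0 <= i < N.+1) conjc z ^+ i.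

Lemma geometric_bounded z : disc z -> normc (conj_geometric z) <= N.+1%:R.
Proof.
move=> Dz; rewrite /conj_geometric; elim: N.+1 => [|n IH].
  by rewrite big_nil Normc.normc0.
rewrite big_nat_recr //= -natr1; apply: le_trans (normc_leD _ _) _; apply: lerD => //.
by rewrite normcX normc_conj exprn_ile1 ?normc_nneg // ltW.
Qed.

Lemma cmeasurable_geometric : cmeasurable conj_geometric.
Proof.
have h : holo (fun z : C^o => \sum_(0 <= i < N.+1) z ^+ i : C^o).
  elim: N.+1 => [|n IH] z Dz.
    have -> : (fun z : C^o => \sum_(0 <= i < 0) z ^+ i : C^o) = fun=> 0.
      by apply/funext => w; rewrite big_nil.
    exact: holo_at_cst.
  have -> : (fun z : C^o => \sum_(0 <= i < n.+1) z ^+ i : C^o) =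
      fun z => \sum_(0 <= i < n) z ^+ i + z ^+ n.
    by apply/funext => w; rewrite big_nat_recr.
  exact: (holo_atD (IH z Dz) (holo_atX n z)).
have := cmeasurable_conj (holo_cmeasurable h); congr cmeasurable; apply/funext => z.
by rewrite /conj_geometric rmorph_sum; apply: eq_bigr => i _; rewrite rmorphXn.
Qed.

Lemma L2_symbol (f : La2) : L2 (flip (fun z => conj_geometric z * f z)).
Proof.
apply: L2_flip; apply: (L2_mul_bounded cmeasurable_geometric geometric_bounded); exact: bergman_L2.
Qed.

Lemma integralC_sum0 n (F : nat -> C -> C^o) :
  (forall i, (i < n)%N -> cintegrable (F i) /\ integralC (F i) = 0) ->
  cintegrable (fun z => \sum_(0 <= i < n) F i z) /\
  integralC (fun z => \sum_(0 <= i < n) F i z) = 0.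
Proof.
elim: n => [|n IH] H.
  have -> : (fun z => \sum_(0 <= i < 0) F i z : C^o) = fun=> 0.
    by apply/funext => z; rewrite big_nil.
  split; first by split; exact: integrable0.
  by rewrite /integralC /Rintegral /= !integral0.
have [I1 I2] := IH (fun i h => H i (ltnW h)); have [J1 J2] := H n (ltnSn n).
have E : (fun z => \sum_(0 <= i < n.+1) F i z : C^o) =
    fun z => 1 * (\sum_(0 <= i < n) F i z) + F n z.
  by apply/funext => z; rewrite big_nat_recr //= mul1r.
rewrite E; split; first exact: cintegrable_lin.
by rewrite integralC_lin // I2 J2 mulr0 addr0.
Qed.

(** Inside a product the conjugation sign denotes Num.conj, elsewhere conjc. *)
Lemma conjE (z : C) : Num.conj z = conjc z. Proof. by []. Qed.

(** The integrand is conjugated: then h and f^# are holomorphic, and the symbol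
contributes conj(z)^i with i <= N against the factor z^(N+1) of f^#. *)
Lemma symbol_orthogonal (f h : La2) (K : C^o -> C^o) : holo K ->
  (forall z, f z = z ^+ N.+1 * K z) ->
  dotL2 (flip (fun z => conj_geometric z * f z)) h = 0.
Proof.
move=> hK fE.
have Lh := bergman_L2 h; have Lf := bergman_L2 f.
rewrite (dotL2C (L2_symbol f) Lh).
suff -> : dotL2 h (flip (fun z => conj_geometric z * f z)) = 0 by rewrite conjc0.
pose F i (z : C) : C^o := z^* ^+ i * z ^+ i.+1 * (z ^+ (N - i) * ((K z^*)^* * h z)).
have E z : h z * (flip (fun z => conj_geometric z * f z) z)^* = \sum_(0 <= i < N.+1) F i z.
  rewrite /flip /conj_geometric /= conjcK rmorphM rmorph_sum /= mulrA mulr_sumr mulr_suml.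
  apply: eq_big_nat => i /andP[_ iN].
  by rewrite fE !rmorphM !rmorphXn /= !conjE !conjcK /F -{1}(subnKC iN) exprD subSS; ring.
rewrite /dotL2; have -> : (fun z => h z * (flip (fun z => conj_geometric z * f z) z)^*) =
  (fun z => \sum_(0 <= i < N.+1) F i z) by apply/funext.
apply: (proj2 (integralC_sum0 _)) => i iN.
have hF : holo (fun z : C^o => z ^+ (N - i) * ((K z^*)^* * h z)).
  by apply: holoM; [exact: holoX|apply: holoM; [exact: holo_sharp|exact: bergman_holo]].
have IF : cintegrable (F i).
  apply: (@eq_cintegrable _ (fun z => z^* ^+ i * (f z^*)^* * h z)).
    move=> z _; rewrite fE rmorphM rmorphXn /= !conjE !conjcK /F -{1}(subnKC iN) exprD subSS.
    ring.
  apply: cintegrable_L2M => //; apply: (@L2_mul_bounded _ _ _ 1).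
  - by have := cmeasurable_conj (holo_cmeasurable (@holoX R i)); congr cmeasurable; apply/funext => z; rewrite rmorphXn.
  - by move=> z Dz; rewrite normcX normc_conj exprn_ile1 ?normc_nneg // ltW.
  - exact: L2_conj (L2_flip Lf).
by split=> //; exact: integralC_holo0.
Qed.

(** The projection is either the default value 0 or a map for which the
orthogonality relation holds; the rest depends only on this alternative. *)
Lemma hankel_spec (H := @little_hankel R conj_geometric) :
  H = (fun=> 0) \/
  forall f h : La2, dotL2 (H f) h = dotL2 (flip (fun z => conj_geometric z * f z)) h.
Proof.
rewrite /H /little_hankel /bergman_projection.
have [[P0 HP0]|nP] := pselect (exists P, @is_bergman_projection R P); last first.
  left; apply/funext => f; rewrite xgetPN // => P HP; apply: nP; by exists P.
right => f h; set P := xget _ _; have HP : is_bergman_projection P by exact: (xgetI _ HP0).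
have := HP _ (L2_symbol f) h.
set G := flip _; have LG : L2 G by exact: L2_symbol.
have -> : (fun z => G z - P G z) = (fun z => -1 * P G z + G z).
  by apply/funext => z; rewrite mulN1r addrC.
rewrite dotL2_lin //; try exact: bergman_L2.
by rewrite mulN1r addrC => /eqP; rewrite subr_eq0 => /eqP.
Qed.

(** By linearity of the inner product, the defect of linearity is orthogonal to
itself. *)
Lemma hankel_linear : linear (@little_hankel R conj_geometric).
Proof.
have [->|HE] := hankel_spec; first by move=> a f g; rewrite scaler0 addr0.
move=> a f g; set H := little_hankel _ in HE *.
pose d : La2 := -1 *: (a *: H f + H g) + H (a *: f + g).
have Ld : L2 d by exact: bergman_L2.
have Hd : dotL2 (H (a *: f + g)) d = a * dotL2 (H f) d + dotL2 (H g) d.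
  rewrite !HE -(dotL2_lin a (L2_symbol f) (L2_symbol g) Ld); congr dotL2.
  by apply/funext => z; rewrite /flip bergman_linE; ring.
have : d = 0 by apply: dotL2_eq0; rewrite {1}/d !dotL2_linB // Hd mulN1r addNr.
by rewrite /d scaleN1r => /eqP; rewrite addr_eq0 eqr_opp => /eqP ->.
Qed.

Lemma hankel_ker (f : La2) : (forall j, (j < N.+1)%N -> taylor_coef j f = 0) ->
  little_hankel conj_geometric f = 0.
Proof.
move=> f0; have [K hK fE] := taylor_coef_remainder f N.+1.
have {}fE z : f z = z ^+ N.+1 * K z.
  by rewrite fE big1 ?add0r // => j _; rewrite f0 ?mul0r.
have [-> //|HE] := hankel_spec.
by apply: dotL2_eq0; rewrite HE; exact: symbol_orthogonal hK fE.
Qed.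

Lemma slant_linear k : linear (@slant R k).
Proof.
rewrite /slant; have [[W0 HW]|nW] := pselect (exists W, @is_slant R k W).
  by have [[lW _] _ _] : is_slant k (xget (fun=> 0) [set W | @is_slant R k W]) by exact: (xgetI _ HW).
rewrite xgetPN; first by move=> a f g; rewrite scaler0 addr0.
by move=> W HW; apply: nW; exists W.
Qed.

End Hankel.

(** f and its Taylor polynomial of degree N have the same image, because their
difference has no Taylor coefficient of index at most N. *)
Lemma slant_little_hankel_finite_rank (R : realType) (k N : nat) (f : bergman R)
    (T := slant_little_hankel k (@conj_geometric R N)) :
  T f = \sum_(j < N.+1) taylor_coef j f *: T (monomial R j).
Proof.
have lT : linear T.
  by move=> a u v; rewrite /T /slant_little_hankel /= hankel_linear slant_linear.
have T0 : T 0 = 0.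
  by apply: double_eq0; have := lT 1 0 0; rewrite !scale1r addr0.
pose p := \sum_(j < N.+1) taylor_coef j f *: monomial R j.
have Tp : T p = \sum_(j < N.+1) taylor_coef j f *: T (monomial R j).
  rewrite /p; elim/big_rec2: _ => [|j x y _ <-]; first exact: T0.
  by rewrite lT.
have cp j : (j < N.+1)%N -> taylor_coef j (-1 *: p + f) = 0.
  move=> jN; rewrite taylor_coef_lin taylor_coef_sum (bigD1 (Ordinal jN)) //= big1.
    rewrite addr0 {2}/taylor_coef divff ?mulr1 ?mulN1r ?addNr //.
    by apply/eqP => /dotL2_eq0; exact: mono_neq0.
  move=> i ij; rewrite {2}/taylor_coef dotL2_mono_orth ?mul0r ?mulr0 //.
  by move: ij; rewrite eq_sym -val_eqE.
have : T (-1 *: p + f) = 0.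
  rewrite /T /slant_little_hankel /= hankel_ker //.
  by apply: double_eq0; have := @slant_linear R k 1 0 0; rewrite !scale1r addr0.
by rewrite lT scaleN1r addrC => /eqP; rewrite subr_eq0 => /eqP ->.
Qed.

Theorem theorem2p7 (R : realType) (k N : nat) (hk : (2 <= k)%N)
    (hN : (N <= 2 * k - 1)%N) :
  let phi : R[i] -> R[i]^o := fun z => \sum_(0 <= i < N.+1) (conjc z) ^+ i in
  approx_point_spectrum (slant_little_hankel k phi) =
    spectrum (slant_little_hankel k phi).
Proof.
move=> phi.
apply: (@finite_rank_spectrum R N.+1 (fun j => taylor_coef j) _
  (fun j => slant_little_hankel k phi (monomial R j)) (monomial R N.+1)).
- by move=> i a f g; exact: taylor_coef_lin.
- exact: slant_little_hankel_finite_rank.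
- exact: mono_neq0.
- by move=> i; rewrite /taylor_coef dotL2_mono_orth ?mul0r // ltn_eqF.
Qed.
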